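(* Let $K=[a,b]$ be a closed interval with $a,b\in\mathbb R$ and $a<b$. Let $y_1,\dots,y_n\in\mathbb R\setminus K$, let $\mathbf t=(t_0,\dots,t_n)$ with $0\le t_i\le1$ and $\sum_{i=0}^nt_i=1$, and let $$\mu_{\mathbf t}:=\mu_{\mathbf t}(\{y_i\},K)=t_0\,\nu_K+\sum_{i=1}^nt_i\,\omega(y_i,K).$$ If $$\int\log|z-a|\,d\mu_{\mathbf t}(z)\ge0\quad\text{and}\quad\int\log|z-b|\,d\mu_{\mathbf t}(z)\ge0,$$ then $\int\log|Q(z)|\,d\mu_{\mathbf t}(z)\ge0$ for all $Q\in\mathbb Z[z]\setminus\{0\}$.
   Context: Potential theory. $\mathcal P(K)$ is the set of Borel probability measures with support contained in the compact set $K$. For a finite compactly supported Borel measure $\mu$, $I(\mu)=\iint\log\frac1{|z-w|}\,d\mu(z)\,d\mu(w)$. The logarithmic capacity of a compact set $K$ is $c(K)=\exp(-\inf_{\mu\in\mathcal P(K)}I(\mu))$; for a general set $E$, $c(E)$ is the supremum of $c(K')$ over compact $K'\subset E$. If $c(K)>0$, the equilibrium measure $\nu_K$ is the unique minimizer of $I$ over $\mathcal P(K)$. ''Quasi-everywhere'' means except on a set of logarithmic capacity zero. For a domain $\Omega\subset\widehat{\mathbb C}$ with $c(\partial\Omega)>0$ and $y\in\Omega$, the harmonic measure $\omega(y,\Omega)$ is the unique Borel probability measure on $\partial\Omega$ with $u(y)=\int f\,d\omega(y,\Omega)$ for every continuous $f$ on $\partial\Omega$, where $u$ is the (bounded) harmonic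 function on $\Omega$ whose boundary values agree with $f$ quasi-everywhere on $\partial\Omega$. For $y\notin K$, $\omega(y,K):=\omega(y,\Omega)$, where $\Omega$ is the connected component of $\widehat{\mathbb C}\setminus K$ containing $y$; it is regarded as a measure on $K$. For $K=[a,b]$ these are explicit: $d\nu_K(x)=\frac{dx}{\pi\sqrt{(x-a)(b-x)}}$ and, for real $y\notin[a,b]$, $d\omega(y,K)(x)=\frac{\sqrt{|(y-a)(y-b)|}}{\pi|y-x|\sqrt{(x-a)(b-x)}}\,dx$, for $a<x<b$. *)

(* Defs.v *)
From HB Require Import structures.
From mathcomp Require Import all_boot all_order all_algebra.
From mathcomp Require Import complex.
From mathcomp Require Import all_classical all_reals all_analysis.

Set Implicit Arguments.
Unset Strict Implicit.
Unset Printing Implicit Defensive.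

Import Order.TTheory GRing.Theory Num.Theory.
Import numFieldNormedType.Exports.

Local Open Scope classical_set_scope.
Local Open Scope ring_scope.

(* The complex plane is represented by R * R, which carries the product
   (i.e. Euclidean) topology, its Borel sigma-algebra and a normed R-module
   structure; none of these is available on R[i].  Complex arithmetic goes
   through [toC].  The library norm `|z| on R * R is the sup norm, so the modulus
   has to be [cabs]. *)
Notation plane R := (R * R)%type.
Notation sphere R := (one_point_compactification (plane R)).

Definition toC (R : realType) (z : plane R) : R[i] := Complex z.1 z.2.

Definition cabs (R : realType) (z : plane R) : R := Normc.normc (toC z).

Definition real_pt (R : realType) (x : R) : plane R := (x, 0).

Definition real_segment (R : realType) (a b : R) : set (plane R) :=
  @real_pt R @` `[a, b].

Definition fin_pt (R : realType) (z : plane R) : sphere R := Some z.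

(* log |z|, with the value -oo at z = 0 *)
Definition log_abs (R : realType) (z : plane R) : \bar R := lne (cabs z)%:E.

(* log |Q(z)| *)
Definition log_abs_poly (R : realType) (Q : {poly int}) (z : plane R) : \bar R :=
  lne (Normc.normc (map_poly (fun m : int => m%:~R : R[i]) Q).[toC z])%:E.

(* For closed A, this says that the support of mu is contained in A. *)
Definition supported_in (R : realType) (mu : {measure set (plane R) -> \bar R})
  (A : set (plane R)) : Prop := mu (~` A) = 0%E.

Definition log_energy (R : realType) (mu : {measure set (plane R) -> \bar R}) :
    \bar R :=
  (\int[mu]_z \int[mu]_w (- log_abs (z - w)%R))%E.

(* Equal to 0 when no measure on K has finite energy, since expeR (-oo) = 0. *)
Definition compact_capacity (R : realType) (K : set (plane R)) : \bar R :=
  expeR (- ereal_inf [set log_energy mu |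
    mu in [set mu : probability (plane R) R | supported_in mu K]])%E.

Definition capacity (R : realType) (E : set (plane R)) : \bar R :=
  ereal_sup [set compact_capacity K | K in [set K | compact K /\ K `<=` E]].

(* When K has positive capacity there is exactly one such measure. *)
Definition is_equilibrium_measure (R : realType) (K : set (plane R))
    (nu : probability (plane R) R) : Prop :=
  supported_in nu K /\
  forall mu : probability (plane R) R, supported_in mu K ->
    (log_energy nu <= log_energy mu)%E.

(* The directions of the two partial derivatives *)
Definition axis (R : realType) (i : bool) : plane R :=
  if i then (0, 1) else (1, 0).

Definition harmonic_at (R : realType) (v : plane R -> R) (z : plane R) : Prop :=
  \forall w \near z,
    [/\ forall i, derivable v w (axis R i),
        forall i j, derivable ('D_(axis R i) v) w (axis R j),
        forall i j,
          {for w, continuous ('D_(axis R j) ('D_(axis R i) v) : plane R -> R)} &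
        'D_(axis R false) ('D_(axis R false) v) w +
        'D_(axis R true) ('D_(axis R true) v) w = 0].

(* The chart w |-> 1/w of the sphere at infinity *)
Definition chart_infty (R : realType) (w : plane R) : sphere R :=
  if w == 0 then None
  else fin_pt (complex.Re (toC w)^-1, complex.Im (toC w)^-1).

Definition harmonic_on (R : realType) (Omega : set (sphere R))
    (u : sphere R -> R) : Prop :=
  (forall z : plane R, Omega (fin_pt z) -> harmonic_at (u \o @fin_pt R) z) /\
  (Omega None -> harmonic_at (u \o @chart_infty R) 0).

(* The boundary of Omega in the sphere, as a subset of the plane: meant for
   domains whose boundary does not contain the point at infinity. *)
Definition plane_boundary (R : realType) (Omega : set (sphere R)) :
    set (plane R) :=
  [set z | closure Omega (fin_pt z) /\ closure (~` Omega) (fin_pt z)].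

(* u is the bounded harmonic function on Omega whose boundary values agree
   quasi-everywhere with f; the values of u outside Omega play no role. *)
Definition solves_dirichlet (R : realType) (Omega : set (sphere R))
    (f : plane R -> R) (u : sphere R -> R) : Prop :=
  [/\ harmonic_on Omega u,
      exists M : R, forall x, Omega x -> `|u x| <= M &
      capacity [set z | plane_boundary Omega z /\
        ~ (u x @[x --> within Omega (nbhs (fin_pt z))] --> f z)] = 0%E].

(* When the boundary of Omega has positive capacity, the Dirichlet problem has
   exactly one solution u for each f, and there is exactly one such measure. *)
Definition is_harmonic_measure (R : realType) (y : sphere R)
    (Omega : set (sphere R)) (mu : probability (plane R) R) : Prop :=
  supported_in mu (plane_boundary Omega) /\
  forall f : plane R -> R, {within plane_boundary Omega, continuous f} ->
  forall u : sphere R -> R, solves_dirichlet Omega f u ->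
    (u y)%:E = (\int[mu]_(z in plane_boundary Omega) (f z)%:E)%E.

Definition is_harmonic_measure_compl (R : realType) (y : sphere R)
    (K : set (plane R)) (mu : probability (plane R) R) : Prop :=
  is_harmonic_measure y (connected_component (~` (@fin_pt R @` K)) y) mu.

Section mixture.
Context d (T : measurableType d) (R : realType) (n : nat).
Variables (t : 'I_n.+1 -> {nonneg R}) (nu : {measure set T -> \bar R})
  (omega : 'I_n -> {measure set T -> \bar R}).
Local Open Scope ereal_scope.

Definition mixture (A : set T) : \bar R :=
  (t ord0)%:num%:E * nu A +
  \sum_(i < n) (t (lift ord0 i))%:num%:E * omega i A.

Let summand (k : nat) : {measure set T -> \bar R} :=
  mscale (t (inord k)) (oapp omega nu (unlift ord0 (inord k))).

Let mixtureE : mixture = msum summand n.+1.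
Proof.
apply/funext => A; rewrite /mixture /msum big_ord_recl /=; congr (_ + _).
  by rewrite /mscale (_ : inord 0 = ord0) ?unlift_none//; apply/val_inj; rewrite /= inordK.
apply: eq_bigr => i _; rewrite /mscale.
rewrite (_ : inord (bump 0 i) = lift ord0 i) ?liftK//.
by apply/val_inj; rewrite /= inordK// ltnS; exact: ltn_ord.
Qed.

Let mixture0 : mixture set0 = 0.
Proof. by rewrite mixtureE measure0. Qed.

Let mixture_ge0 A : 0 <= mixture A.
Proof. by rewrite mixtureE measure_ge0. Qed.

Let mixture_semi_sigma_additive : semi_sigma_additive mixture.
Proof. by rewrite mixtureE; exact: measure_semi_sigma_additive. Qed.

HB.instance Definition _ := isMeasure.Build d T R mixture
  mixture0 mixture_ge0 mixture_semi_sigma_additive.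

End mixture.

(* Main.v *)
Require Import Defs.
From HB Require Import structures.
From mathcomp Require Import all_boot all_order all_algebra.
From mathcomp Require Import complex.
From mathcomp Require Import all_classical all_reals all_analysis.
From mathcomp Require Import measurable_realfun.
From mathcomp Require Import ring lra.

Set Implicit Arguments.
Unset Strict Implicit.
Unset Printing Implicit Defensive.

Import Order.TTheory GRing.Theory Num.Theory.
Import numFieldNormedType.Exports.
Import Normc.

Local Open Scope classical_set_scope.
Local Open Scope ring_scope.

(** Rescale [a, b] to [-1, 1] and write the points of the plane as X = J(w),
    where J(w) = (w + 1/w) / 2 and 0 < |w| <= 1.  Let T_k be the Chebyshev
    polynomials.  For |w| < 1 and s in [-1, 1],

      log |1 - 2 s w + w^2| = - sum_{k >= 1} (2 / k) Re(w^k) T_k(s),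

    and |s - J(w)| = |1 - 2 s w + w^2| / (2 |w|).  So the potential of a
    probability measure on the segment is determined by its Chebyshev moments.

    Moments.  The function X |-> Re(w(X)^k) is harmonic off the segment, infinity
    included, and has boundary values T_k.  Hence the k-th moment of the harmonic
    measure at y is eta^k, where y = J(eta) with eta real and |eta| < 1
    ([harmonic_moments]).  For k >= 1 the moments of the equilibrium measure
    vanish ([equilibrium_moments]): the energy is, up to a constant, the sum of
    (2 / k) c_k^2 over the moments c_k, and it does not exceed that of the arcsine
    law, all of whose moments are zero.  So the equilibrium measure behaves as the
    harmonic measure at infinity, with eta = 0.

    Potential.  If the k-th moments are sum_j t_j eta_j^k, then summing the series
    gives, at the point J(w),

      U(J(w)) = sum_j t_j log(|1 - eta_j w|^2 / |w|) + log(h / 2),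

    where h is the half-length of the segment ([integral_log_abs]); on the circle
    |w| = 1 this is a monotone limit, taken in [integral_lne_kern].

    Minimum.  With e = w / |w|, the quotient |1 - eta w|^2 / |w| is at least
    |1 - eta e|^2, and this is affine in Re e, so it lies between its values
    (1 - eta)^2 at e = 1 and (1 + eta)^2 at e = -1, with the same weights for all
    eta.  Concavity of log then bounds U from below by a convex combination of its
    values at the two endpoints ([mixpot_lower]).  If these are nonnegative, so is
    U on the whole plane.

    Finally log |Q| is the sum of log |lead Q|, which is nonnegative since lead Q
    is a nonzero integer, and of the log |z - r| over the complex roots r of Q,
    each of which has integral U(r) >= 0. *)


(** * Modulus and real part in R[i] *)

Section modulus.
Variable R : realType.
Implicit Types (x y : R) (z w c : R[i]).

Lemma normc_sqr z : normc z ^+ 2 = complex.Re z ^+ 2 + complex.Im z ^+ 2.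
Proof. by case: z => x y /=; rewrite sqr_sqrtr// addr_ge0// sqr_ge0. Qed.

Lemma normc_ge0 z : 0 <= normc z.
Proof. by case: z => x y /=; rewrite sqrtr_ge0. Qed.

Lemma normc_gt0 z : (0 < normc z) = (z != 0).
Proof.
rewrite lt_neqAle normc_ge0 andbT eq_sym; congr negb.
by apply/eqP/eqP => [/eq0_normc//|->]; rewrite normc0.
Qed.

Lemma normc_real x : normc x%:C%C = `|x|.
Proof. by rewrite /= expr0n addr0 sqrtr_sqr. Qed.

Lemma normcX z n : normc (z ^+ n) = normc z ^+ n.
Proof. by elim: n => [|n ih]; rewrite ?expr0 ?normc1// !exprS normcM ih. Qed.

Lemma cnormJ z : normc (z^*)%C = normc z.
Proof. by case: z => x y /=; rewrite sqrrN. Qed.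

Lemma Re_le_normc z : `|complex.Re z| <= normc z.
Proof.
rewrite -(@ler_pXn2r _ 2%N)// ?nnegrE ?normc_ge0//.
by rewrite normc_sqr real_normK ?num_real// lerDl sqr_ge0.
Qed.

Lemma Im_le_normc z : `|complex.Im z| <= normc z.
Proof.
rewrite -(@ler_pXn2r _ 2%N)// ?nnegrE ?normc_ge0//.
by rewrite normc_sqr real_normK ?num_real// lerDr sqr_ge0.
Qed.

Lemma ler_normcB z w : normc z - normc w <= normc (z - w).
Proof. by rewrite lerBlDr; apply: le_trans (le_normcD _ _); rewrite subrK. Qed.

Lemma conjcX z n : (z ^+ n)^*%C = (z^*)%C ^+ n.
Proof. exact: rmorphXn. Qed.

Lemma cReD z w : complex.Re (z + w) = complex.Re z + complex.Re w.
Proof. by case: z; case: w. Qed.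

Lemma cReJ z : complex.Re (z^*)%C = complex.Re z.
Proof. by case: z. Qed.

Lemma cReM z w : complex.Re (z * w) =
  complex.Re z * complex.Re w - complex.Im z * complex.Im w.
Proof. by case: z; case: w. Qed.

Lemma cImM z w : complex.Im (z * w) =
  complex.Re z * complex.Im w + complex.Im z * complex.Re w.
Proof. by case: z => a b; case: w => c d /=. Qed.

Lemma cReZ x z : complex.Re (x%:C%C * z) = x * complex.Re z.
Proof. by rewrite cReM /= mul0r subr0. Qed.

Lemma invcE z : z^-1 = ((normc z ^+ 2)^-1)%:C%C * (z^*)%C.
Proof.
by rewrite normc_sqr; case: z => x y; apply/eqP; rewrite eq_complex/=;
   apply/andP; split; apply/eqP; ring.
Qed.

End modulus.

(** * The logarithm of the modulus as a power series *)

Section log_series.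
Variable R : realType.
Variable c : R[i].
Hypothesis c1 : normc c < 1.

Let q (t : R) := 1 - 2 * complex.Re c * t + normc c ^+ 2 * t ^+ 2.

Let qE t : q t = normc (1 - t%:C%C * c) ^+ 2.
Proof. by rewrite normc_sqr /q normc_sqr; case: (c) => x y /=; ring. Qed.

Let q_gt0 t : 0 <= t <= 1 -> 0 < q t.
Proof.
move=> /andP[t0 t1]; rewrite qE exprn_gt0//.
have := ler_normcB 1 (t%:C%C * c); rewrite normc1 normcM normc_real ger0_norm//.
apply: lt_le_trans; rewrite subr_gt0.
by apply: le_lt_trans c1; rewrite ler_piMl ?normc_ge0.
Qed.

Let f n (t : R) := 2^-1 * ln (q t) +
  \sum_(k < n) complex.Re (c ^+ k.+1) / k.+1%:R * t ^+ k.+1.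

Let df n (t : R) := 2^-1 * ((q t)^-1 * (- (2 * complex.Re c) + normc c ^+ 2 * (2 * t)))
  + \sum_(k < n) complex.Re (c ^+ k.+1) * t ^+ k.

Let is_derive_f n (t : R) : 0 <= t <= 1 -> is_derive t 1 (f n) (df n t).
Proof.
move=> /q_gt0 qt0.
have dq : is_derive t 1 q (- (2 * complex.Re c) + normc c ^+ 2 * (2 * t)).
  apply: is_derive_eq; rewrite /GRing.scale/=; ring.
have dl : is_derive t 1 (fun t => ln (q t))
    ((q t)^-1 * (- (2 * complex.Re c) + normc c ^+ 2 * (2 * t))).
  exact: (@is_derive1_comp _ _ _ _ _ _ (is_derive1_ln qt0) dq).
have ds : is_derive t 1
    (fun t => \sum_(k < n) complex.Re (c ^+ k.+1) / k.+1%:R * t ^+ k.+1)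
    (\sum_(k < n) complex.Re (c ^+ k.+1) * t ^+ k).
  rewrite [X in is_derive _ _ X](_ : _ =
      \sum_(k < n) (fun t => complex.Re (c ^+ k.+1) / k.+1%:R * t ^+ k.+1)).
    apply: is_derive_sum => k.
    have -> : (fun t => complex.Re (c ^+ k.+1) / k.+1%:R * t ^+ k.+1) =
        complex.Re (c ^+ k.+1) / k.+1%:R *: (@idfun R ^+ k.+1).
      by apply/funext => u; rewrite /GRing.scale/= exprfctE.
    apply: is_derive_eq; rewrite /GRing.scale/= -!mulrA; congr (_ * _).
    by rewrite mulr1 mulrA mulVf ?mul1r ?pnatr_eq0.
  by apply/funext => u; rewrite fct_sumE.
exact: (is_deriveD (is_deriveZ 2^-1 dl) ds).
Qed.

Let dfE n t : 0 <= t <= 1 ->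
  df n t = complex.Re (- c * (t%:C%C * c) ^+ n / (1 - t%:C%C * c)).
Proof.
move=> t01; have q0 := q_gt0 t01.
have ne0 : 1 - t%:C%C * c != 0.
  by rewrite -normc_gt0 -(@ltr_pXn2r _ 2)// ?nnegrE ?normc_ge0// expr0n/= -qE.
elim: n => [|n ih].
  rewrite /df big_ord0 addr0 expr0 mulr1.
  have -> : - c / (1 - t%:C%C * c) =
      ((q t)^-1)%:C%C * (- c * (1 - t%:C%C * c)^*%C).
    by rewrite qE invcE mulrCA.
  rewrite cReZ mulrCA; congr (_ * _); rewrite normc_sqr.
  by case: (c) => x y /=; field.
rewrite /df big_ord_recr/= addrA -/(df n t) ih.
have -> : complex.Re (c ^+ n.+1) * t ^+ n =
    complex.Re (c * (t%:C%C * c) ^+ n).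
  by rewrite exprMn -rmorphXn/= mulrCA -exprS cReZ mulrC.
by rewrite -cReD; congr complex.Re; rewrite exprS; field.
Qed.

(** The remainder is explicit: on the ray t c the derivative in t of
    the quantity to bound telescopes to Re(- c (t c)^n / (1 - t c)), and the mean
    value theorem applies.  The bound depends on c through its modulus alone, so
    that the expansion may be integrated with finite sums only. *)
Lemma ln_normc_series n :
  `|ln (normc (1 - c)) + \sum_(k < n) complex.Re (c ^+ k.+1) / k.+1%:R| <=
  normc c ^+ n.+1 / (1 - normc c).
Proof.
have [t t01 e] : exists2 t : R, t \in `[0, 1]%R & f n 1 - f n 0 = df n t * (1 - 0).
  apply: MVT_segment => //.
    by move=> x /andP[/ltW x0 /ltW x1]; apply: is_derive_f; rewrite x0 x1.
  apply: derivable_within_continuous => x; rewrite in_itv/= => x01.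
  by have [] := is_derive_f n x01.
have := t01; rewrite in_itv/= => /andP[t0 t1].
have -> : ln (normc (1 - c)) + \sum_(k < n) complex.Re (c ^+ k.+1) / k.+1%:R =
    df n t.
  rewrite subr0 mulr1 in e; rewrite -e /f.
  have -> : q 0 = 1 by rewrite /q; ring.
  rewrite ln1 mulr0 add0r [X in _ = _ - X]big1 ?subr0; last first.
    by move=> k _; rewrite expr0n/= mulr0.
  congr (_ + _); last by apply: eq_bigr => k _; rewrite expr1n mulr1.
  rewrite qE mul1r expr2.
  have n0 : normc (1 - c) \is Num.pos.
    rewrite posrE; have := ler_normcB 1 c; rewrite normc1.
    by apply: lt_le_trans; rewrite subr_gt0.
  by rewrite lnM//; field.
rewrite dfE ?t0//; apply: le_trans (Re_le_normc _) _.
rewrite !normcM normcN normcV normcX normcM normc_real ger0_norm//.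
have n1 : normc (1 - c) >= 1 - normc c.
  by have := ler_normcB 1 c; rewrite normc1.
have tc1 : t * normc c <= normc c by rewrite ler_piMl ?normc_ge0.
have n2 : 1 - normc c <= normc (1 - t%:C%C * c).
  have := ler_normcB 1 (t%:C%C * c); rewrite normc1 normcM normc_real ger0_norm//.
  by apply: le_trans; rewrite lerB.
rewrite exprS; apply: ler_pM.
- by rewrite mulr_ge0 ?exprn_ge0 ?mulr_ge0 ?normc_ge0.
- by rewrite invr_ge0 normc_ge0.
- by rewrite ler_wpM2l ?normc_ge0// lerXn2r ?nnegrE ?mulr_ge0 ?normc_ge0.
- by rewrite lef_pV2 ?posrE ?(lt_le_trans _ n2)// subr_gt0.
Qed.

End log_series.

(** * Chebyshev polynomials, the logarithmic kernel and the Joukowski map *)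

Section circle.
Variable R : realType.
Implicit Types (s r : R) (w z : R[i]).

(** The point e^{i theta} of the upper unit half-circle with cos theta = s. *)
Definition upper_circle s : R[i] := Complex s (Num.sqrt (1 - s ^+ 2)).
(** The Chebyshev polynomial T_k on [-1, 1], since T_k(cos theta) is
    Re (e^{i theta})^k; this form extends continuously to the whole line. *)
Definition cheb k s : R := complex.Re (upper_circle s ^+ k).
(** Up to the factor 2 |w|, the distance from s to [jouk w]; see
    [normc_jouk_sub].  It is polynomial in w, hence defined at w = 0 too. *)
Definition kern w s : R := normc (1 - 2 * s%:C%C * w + w ^+ 2).

Lemma normc_upper_circle s : -1 <= s <= 1 -> normc (upper_circle s) = 1.
Proof.
move=> s1; rewrite /= sqr_sqrtr; last by nra.
by rewrite addrC subrK sqrtr1.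
Qed.

Lemma cheb_le1 k s : -1 <= s <= 1 -> `|cheb k s| <= 1.
Proof.
move=> s1; apply: le_trans (Re_le_normc _) _.
  rewrite normcX normc_upper_circle// expr1n.
Qed.

(** The roots of 1 - 2 s w + w^2 are e^{i theta} and e^{-i theta}. *)
Lemma kernE w s : -1 <= s <= 1 ->
  kern w s = normc (1 - w * upper_circle s) * normc (1 - w * (upper_circle s)^*%C).
Proof.
move=> s1; rewrite -normcM; congr normc.
have e : upper_circle s * (upper_circle s)^*%C = 1.
  apply/eqP; rewrite eq_complex /=; apply/andP; split; apply/eqP; last by ring.
  by rewrite mulrN opprK -!expr2 sqr_sqrtr; [ring|nra].
have e2 : upper_circle s + (upper_circle s)^*%C = 2 * s%:C%C.
  by apply/eqP; rewrite eq_complex /=; apply/andP; split; apply/eqP; ring.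
have -> : w ^+ 2 = w * w * (upper_circle s * (upper_circle s)^*%C) by rewrite e; ring.
by rewrite -e2; ring.
Qed.

Lemma ln_kern_series w s n : normc w < 1 -> -1 <= s <= 1 ->
  `|ln (kern w s) + \sum_(k < n) 2 * complex.Re (w ^+ k.+1) * cheb k.+1 s / k.+1%:R|
  <= 2 * normc w ^+ n.+1 / (1 - normc w).
Proof.
move=> w1 s1.
have c1 : normc (w * upper_circle s) < 1 by rewrite normcM normc_upper_circle ?mulr1.
have c2 : normc (w * (upper_circle s)^*%C) < 1 by rewrite normcM cnormJ normc_upper_circle ?mulr1.
have pos (c : R[i]) : normc c < 1 -> normc (1 - c) \is Num.pos.
  move=> cl; rewrite posrE; have := ler_normcB 1 c; rewrite normc1.
  by apply: lt_le_trans; rewrite subr_gt0.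
rewrite kernE// lnM ?pos//.
have -> : \sum_(k < n) 2 * complex.Re (w ^+ k.+1) * cheb k.+1 s / k.+1%:R =
  \sum_(k < n) complex.Re ((w * upper_circle s) ^+ k.+1) / k.+1%:R +
  \sum_(k < n) complex.Re ((w * (upper_circle s)^*%C) ^+ k.+1) / k.+1%:R.
  rewrite /cheb; move: (upper_circle s) => u.
  rewrite -big_split/=; apply: eq_bigr => k _.
  rewrite -mulrDl; congr (_ / _).
  rewrite !exprMn -conjcX.
  by case: (w ^+ _) => a b; case: (u ^+ _) => c d /=; ring.
rewrite addrACA; apply: le_trans (ler_normD _ _) _.
have := ln_normc_series c1 n; have := ln_normc_series c2 n.
rewrite !normcM cnormJ normc_upper_circle// !mulr1 => h1 h2.
apply: le_trans (lerD h2 h1) _; rewrite -mulrA; lra.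
Qed.

(** The difference of the two sides is (1 - r) (1 - r |c|^2). *)
Lemma normc_radial (c : R[i]) r : 0 <= r <= 1 -> normc c <= 1 ->
  r * normc (1 - c) ^+ 2 <= normc (1 - r%:C%C * c) ^+ 2.
Proof.
move=> r01 c1; have : normc c ^+ 2 <= 1 by rewrite expr_le1// normc_ge0.
rewrite !normc_sqr; case: c c1 => x y /= _ h.
have : 0 <= (1 - r) * (1 - r * (x ^+ 2 + y ^+ 2)).
  case/andP: r01 => r0 r1.
  by rewrite mulr_ge0 ?subr_ge0// mulr_ile1// addr_ge0 ?sqr_ge0.
lra.
Qed.

(** The Joukowski map, which sends the punctured unit disc conformally onto the
    complement of [-1, 1] and folds the unit circle onto [-1, 1]. *)
Definition jouk w : R[i] := (w + w^-1) / 2.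

(** This identity gives the injectivity, the continuity and the derivative of
    the inverse of the Joukowski map. *)
Lemma jouk_sub w1 w2 : w1 != 0 -> w2 != 0 ->
  (w1 - w2) * (w1 * w2 - 1) = 2 * (w1 * w2) * (jouk w1 - jouk w2).
Proof. by move=> a b; rewrite /jouk; field; rewrite a b. Qed.

(** The two preimages of X are the roots of w^2 - 2 X w + 1, whose product is 1. *)
Lemma jouk_surj (X : R[i]) : exists w, [/\ w != 0, normc w <= 1 & X = jouk w].
Proof.
have q : (sqrtc (X ^+ 2 - 1)) ^+ 2 = X ^+ 2 - 1 by rewrite sqr_sqrtc.
set q0 := sqrtc _ in q.
have e : (X - q0) * (X + q0) = 1.
  by rewrite -subr_sqr q; ring.
have n1 : X - q0 != 0 by apply: contra_eq_neq e => ->; rewrite mul0r eq_sym oner_neq0.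
have n2 : X + q0 != 0 by apply: contra_eq_neq e => ->; rewrite mulr0 eq_sym oner_neq0.
have i1 : (X - q0)^-1 = X + q0 by rewrite -[LHS]mulr1 -e mulKf.
have i2 : (X + q0)^-1 = X - q0 by rewrite -[LHS]mulr1 -e mulrCA mulVf ?mulr1.
have [h|h] := leP (normc (X - q0)) 1.
  by exists (X - q0); split => //; rewrite /jouk i1; field.
exists (X + q0); split => //; last by rewrite /jouk i2; field.
by rewrite -i1 normcV invf_le1 ?ltW// (lt_trans _ h).
Qed.

Lemma jouk_inj w1 w2 : w1 != 0 -> w2 != 0 -> normc w1 < 1 -> normc w2 <= 1 ->
  jouk w1 = jouk w2 -> w1 = w2.
Proof.
move=> a b n1 n2 e.
have /eqP := jouk_sub a b; rewrite e subrr mulr0 mulf_eq0 => /orP[|/eqP/subr0_eq f].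
  by rewrite subr_eq0 => /eqP.
have : normc (w1 * w2) < 1.
  rewrite normcM; apply: le_lt_trans n1.
  by rewrite ler_piMr ?normc_ge0.
by rewrite f normc1 ltxx.
Qed.

Lemma jouk_unit w : normc w = 1 -> jouk w = (complex.Re w)%:C%C.
Proof.
move=> w1; rewrite /jouk invcE w1 expr1n invr1 mul1r.
by case: w {w1} => x y; apply/eqP; rewrite eq_complex/=; apply/andP; split; apply/eqP; field.
Qed.

Lemma jouk_upper_circle s : -1 <= s <= 1 -> jouk (upper_circle s) = s%:C%C.
Proof. by move=> s1; rewrite jouk_unit ?normc_upper_circle. Qed.

Lemma normc_jouk_sub w s : w != 0 ->
  normc (s%:C%C - jouk w) = kern w s / (2 * normc w).
Proof.
move=> w0.
have -> : s%:C%C - jouk w = (-1) * (1 - 2 * s%:C%C * w + w ^+ 2) / (2 * w).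
  by rewrite /jouk; field.
rewrite !normcM normcV normcM normcN normc1 mul1r /kern; congr (_ / (_ * _)).
by rewrite (normcMn 1 2) normc1.
Qed.

End circle.

(** * Limits of complex-valued maps *)

Section ccvg.
Variable R : realType.
Context {T : Type} {F : set_system T} {FF : Filter F}.
Implicit Types (f g : T -> R[i]) (l k : R[i]).

(** Limits are taken componentwise, so that those of real parts, which are what
    harmonic functions need, can be read off directly. *)
Definition ccvg (G : set_system T) f l :=
  complex.Re (f x) @[x --> G] --> complex.Re l /\
  complex.Im (f x) @[x --> G] --> complex.Im l.

Lemma ccvg_cst l : ccvg F (fun=> l) l.
Proof. by split; exact: cvg_cst. Qed.

Lemma ccvgD f g l k : ccvg F f l -> ccvg F g k ->
  ccvg F (fun x => f x + g x) (l + k).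
Proof.
move=> [fr fi] [gr gi]; rewrite /ccvg.
have reD u v : complex.Re (u + v : R[i]) = complex.Re u + complex.Re v by case: u; case: v.
have imD u v : complex.Im (u + v : R[i]) = complex.Im u + complex.Im v by case: u; case: v.
rewrite reD imD; split.
  by under eq_fun do rewrite reD; exact: cvgD.
by under eq_fun do rewrite imD; exact: cvgD.
Qed.

Lemma ccvgN f l : ccvg F f l -> ccvg F (fun x => - f x) (- l).
Proof.
move=> [fr fi]; rewrite /ccvg.
have reN (u : R[i]) : complex.Re (- u) = - complex.Re u by case: u.
have imN (u : R[i]) : complex.Im (- u) = - complex.Im u by case: u.
rewrite reN imN; split.
  by under eq_fun do rewrite reN; exact: cvgN.
by under eq_fun do rewrite imN; exact: cvgN.
Qed.

Lemma ccvgM f g l k : ccvg F f l -> ccvg F g k ->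
  ccvg F (fun x => f x * g x) (l * k).
Proof.
move=> [fr fi] [gr gi]; rewrite /ccvg cReM cImM; split.
  by under eq_fun do rewrite cReM; apply: cvgB; exact: cvgM.
by under eq_fun do rewrite cImM; apply: cvgD; exact: cvgM.
Qed.

Lemma ccvg_normc2 f l : ccvg F f l -> normc (f x) ^+ 2 @[x --> F] --> normc l ^+ 2.
Proof.
move=> [fr fi]; rewrite normc_sqr.
under eq_fun do rewrite normc_sqr !expr2.
by rewrite !expr2; apply: cvgD; exact: cvgM.
Qed.

Lemma ccvg_normc f l : ccvg F f l -> normc (f x) @[x --> F] --> normc l.
Proof.
move=> /ccvg_normc2 fl.
have e z : normc (z : R[i]) = Num.sqrt (normc z ^+ 2).
  by rewrite sqrtr_sqr ger0_norm ?normc_ge0.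
rewrite e; under eq_fun do rewrite e.
exact: (continuous_cvg _ (@sqrt_continuous _ _) fl).
Qed.

Lemma ccvgV f l : l != 0 -> ccvg F f l -> ccvg F (fun x => (f x)^-1) l^-1.
Proof.
move=> l0 fl; have [fr fi] := fl; have n := ccvg_normc2 fl.
have n0 : normc l ^+ 2 != 0 by rewrite expf_neq0// gt_eqF// normc_gt0.
have reV (z : R[i]) : complex.Re z^-1 = (normc z ^+ 2)^-1 * complex.Re z.
  by rewrite invcE cReZ; case: z.
have imV (z : R[i]) : complex.Im z^-1 = (normc z ^+ 2)^-1 * - complex.Im z.
  by rewrite invcE cImM /= mul0r addr0; case: z.
rewrite /ccvg reV imV; split.
  by under eq_fun do rewrite reV; apply: cvgM => //; exact: cvgV.
by under eq_fun do rewrite imV; apply: cvgM; [exact: cvgV|exact: cvgN].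
Qed.

Lemma ccvgX f l n : ccvg F f l -> ccvg F (fun x => f x ^+ n) (l ^+ n).
Proof.
move=> fl; elim: n => [|n ih]; first exact: ccvg_cst.
by rewrite exprS; under eq_fun do rewrite exprS; exact: ccvgM.
Qed.

Lemma ccvg_real (f : T -> R) (l : R) : f x @[x --> F] --> l ->
  ccvg F (fun x => (f x)%:C%C) l%:C%C.
Proof. by move=> fl; split => //=; exact: cvg_cst. Qed.

Lemma ccvg_squeeze f l (e : T -> R) :
  (\forall x \near F, normc (f x - l) <= e x) -> e x @[x --> F] --> 0 ->
  ccvg F f l.
Proof.
move=> fe e0.
have reB (u v : R[i]) : complex.Re (u - v) = complex.Re u - complex.Re v by case: u; case: v.
have imB (u v : R[i]) : complex.Im (u - v) = complex.Im u - complex.Im v by case: u; case: v.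
have sq (g : R[i] -> R) : (forall u v, g (u - v) = g u - g v) ->
    (forall u, `|g u| <= normc u) -> g (f x) @[x --> F] --> g l.
  move=> gB gn; apply/cvgrPdist_le => eps eps0.
  move/cvgrPdist_le : e0 => /(_ _ eps0) e0.
  near=> x.
  rewrite distrC -gB; apply: le_trans (gn _) _.
  apply: (@le_trans _ _ (e x)); first by near: x.
  have : `|0 - e x| <= eps by near: x.
  by rewrite sub0r normrN; apply: le_trans; exact: ler_norm.
by split; apply: sq => // u; [exact: Re_le_normc|exact: Im_le_normc].
Unshelve. all: by end_near. Qed.

End ccvg.

(** * Continuity and radial monotonicity of the kernel *)

Section kernel_cont.
Variable R : realType.

Lemma upper_circle_cvg (s : R) : ccvg (nbhs s) (@upper_circle R) (upper_circle s).
Proof.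
split => /=; first exact: cvg_id.
apply: (continuous_cvg _ (@sqrt_continuous _ _)).
apply: cvgB; first exact: cvg_cst.
by rewrite expr2; under eq_fun do rewrite expr2; apply: cvgM; exact: cvg_id.
Qed.

Lemma cheb_continuous k : continuous (@cheb R k).
Proof. by move=> s; have [] := ccvgX k (upper_circle_cvg s). Qed.

Lemma kern_continuous (w : R[i]) : continuous (kern w).
Proof.
move=> s; apply: ccvg_normc; apply: ccvgD; last exact: ccvg_cst.
apply: ccvgD; first exact: ccvg_cst.
apply: ccvgN; apply: ccvgM; last exact: ccvg_cst.
apply: ccvgM; first exact: ccvg_cst.
by apply: ccvg_real; exact: cvg_id.
Qed.

Lemma kern_scale_cvg (w : R[i]) (s : R) (r : R^nat) : r n @[n --> \oo] --> (1 : R) ->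
  kern ((r n)%:C%C * w) s @[n --> \oo] --> kern w s.
Proof.
move=> r1; have rw : ccvg \oo (fun n => (r n)%:C%C * w) w.
  by rewrite -[X in ccvg _ _ X]mul1r; apply: ccvgM; [exact: ccvg_real|exact: ccvg_cst].
apply: ccvg_normc; apply: ccvgD; last exact: ccvgX.
apply: ccvgD; first exact: ccvg_cst.
by apply: ccvgN; apply: ccvgM => //; exact: ccvg_cst.
Qed.

Lemma kern_ge0 (w : R[i]) s : 0 <= kern w s. Proof. exact: normc_ge0. Qed.

Lemma normc_mul_upper_circle (w : R[i]) s : -1 <= s <= 1 -> normc (w * upper_circle s) = normc w.
Proof. by move=> s1; rewrite normcM normc_upper_circle ?mulr1. Qed.

Lemma normc_mul_conj (w z : R[i]) : normc (w * (z^*)%C) = normc (w * z).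
Proof. by rewrite !normcM cnormJ. Qed.

Lemma kern_gt0 (w : R[i]) s : normc w < 1 -> -1 <= s <= 1 -> 0 < kern w s.
Proof.
move=> w1 s1; rewrite kernE//.
have pos (c : R[i]) : normc c < 1 -> 0 < normc (1 - c).
  move=> cl; have := ler_normcB 1 c; rewrite normc1.
  by apply: lt_le_trans; rewrite subr_gt0.
by apply: mulr_gt0; apply: pos; rewrite ?normc_mul_conj ?normc_mul_upper_circle.
Qed.

Lemma kern_le4 (w : R[i]) s : normc w <= 1 -> -1 <= s <= 1 -> kern w s <= 4.
Proof.
move=> w1 s1; rewrite kernE// (_ : 4 = 2 * 2); last by ring.
have le2 (c : R[i]) : normc c <= 1 -> normc (1 - c) <= 2.
  move=> cl; apply: le_trans (le_normcD _ _) _; rewrite normcN normc1; lra.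
by apply: ler_pM; rewrite ?normc_ge0//; apply: le2; rewrite ?normc_mul_conj ?normc_mul_upper_circle.
Qed.

(** Equivalently, kern (r w) s / r is nonincreasing in r, which makes
    the passage to the unit circle a monotone limit. *)
Lemma kern_radial (w : R[i]) (r s : R) : 0 <= r <= 1 -> normc w <= 1 -> -1 <= s <= 1 ->
  r * kern w s <= kern (r%:C%C * w) s.
Proof.
move=> r01 w1 s1; rewrite -(@ler_pXn2r _ 2)// ?nnegrE ?mulr_ge0 ?kern_ge0//; last by case/andP: r01.
rewrite !kernE// !exprMn [r ^+ 2]expr2 mulrACA -![r%:C%C * w * _]mulrA.
have n2 c : 0 <= normc (c : R[i]) ^+ 2 by rewrite exprn_ge0 ?normc_ge0.
have [r0 _] := andP r01.
by apply: ler_pM; rewrite ?(mulr_ge0 r0)// ?normc_ge0//; apply: normc_radial => //;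
  rewrite ?normc_mul_conj ?normc_mul_upper_circle.
Qed.

Lemma lne_measurable : measurable_fun [set: R] (fun x : R => lne x%:E).
Proof.
apply: measurable_fun_ifT => //=.
  by apply: measurable_fun_ler => //.
exact/measurable_EFinP.
Qed.

Lemma lne_cvg (u : R^nat) (l : R) : u n @[n --> \oo] --> l -> 0 <= l ->
  (forall n, 0 < u n) -> lne (u n)%:E @[n --> \oo] --> lne l%:E.
Proof.
move=> ul l0 u0; under eq_fun do rewrite lne_EFin//.
move: l0; rewrite le_eqVlt => /predU1P[l0|l0].
  rewrite -l0 /= lexx; apply/cvgeNyPle => A.
  move/cvgrPdist_lt : ul => /(_ (expR A) (expR_gt0 _)) ul.
  near=> n; rewrite lee_fin -(expRK A) ler_ln ?posrE ?expR_gt0//.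
  have : `|l - u n| < expR A by near: n.
  by rewrite -l0 sub0r normrN gtr0_norm// => /ltW.
rewrite lne_EFin//; apply: cvg_EFin; first exact: nearW.
exact: (continuous_cvg _ (continuous_ln l0) ul).
Unshelve. all: by end_near. Qed.

Lemma geometric_bound_eq0 (x K q : R) : 0 <= q < 1 -> (forall n, `|x| <= K * q ^+ n) -> x = 0.
Proof.
move=> /andP[q0 q1] h; apply/normr0_eq0/eqP; rewrite eq_le normr_ge0 andbT.
have c : K * q ^+ n @[n --> \oo] --> (0 : R).
  by apply: cvg_geometric; rewrite ger0_norm.
by apply: (cvgr_to_ge c); exact: nearW.
Qed.

End kernel_cont.

(** * Integrals of bounded functions for a measure of mass one *)

Section probability_measure_integrals.
Context d (T : measurableType d) (R : realType).
Variable mu : {measure set T -> \bar R}.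
Hypothesis mu1 : mu setT = 1%E.

Lemma bounded_integrable (f : T -> R) M : measurable_fun setT f ->
  (forall x, `|f x| <= M) -> mu.-integrable setT (EFin \o f).
Proof.
move=> mf fM; apply: measurable_bounded_integrable => //.
  by rewrite mu1 ltry.
exists M; split; first exact: num_real.
by move=> y My x _; apply: le_trans (fM x) (ltW My).
Qed.

Lemma Rintegral_cst1 r : (\int[mu]_x r)%R = r.
Proof. by rewrite Rintegral_cst// mu1/= mulr1. Qed.

Lemma le_norm_Rintegral (f : T -> R) M : measurable_fun setT f ->
  (forall x, `|f x| <= M) -> `|\int[mu]_x f x| <= M.
Proof.
move=> mf fM; apply: le_trans (le_normr_Rintegral _ _) _ => //.
  exact: bounded_integrable fM.
rewrite -[leRHS]Rintegral_cst1; apply: le_Rintegral => //.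
- apply: (bounded_integrable (M := M)) => [|x]; last by rewrite normr_id.
  exact: measurableT_comp.
- exact: (bounded_integrable (M := `|M|)).
Qed.

Lemma Rintegral_lin (f : nat -> T -> R) (c : nat -> R) n :
  (forall k, measurable_fun setT (f k)) -> (forall k x, `|f k x| <= 1) ->
  (\int[mu]_x (\sum_(k < n) c k * f k x) = \sum_(k < n) c k * \int[mu]_x f k x)%R.
Proof.
move=> mf f1.
have bnd m x : `|\sum_(k < m) c k * f k x| <= \sum_(k < m) `|c k|.
  apply: le_trans (ler_norm_sum _ _ _) _; apply: ler_sum => k _.
  by rewrite normrM ler_piMr.
have ms m : measurable_fun setT (fun x => \sum_(k < m) c k * f k x).
  by apply: measurable_sum => k; exact: measurable_funM.
elim: n => [|n ih].
  by under eq_Rintegral do rewrite big_ord0; rewrite Rintegral_cst1 big_ord0.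
under eq_Rintegral do rewrite big_ord_recr/=.
have fi k : mu.-integrable setT (EFin \o f k) by apply: (bounded_integrable (M := 1)).
rewrite RintegralD// ?ih ?big_ord_recr/= ?RintegralZl//.
  exact: bounded_integrable (bnd n).
apply: (bounded_integrable (M := `|c n|)) => [|x]; first exact: measurable_funM.
by rewrite normrM ler_piMr.
Qed.

End probability_measure_integrals.

(** * The potential of a measure with given Chebyshev moments *)

Section potential.
Context d (T : measurableType d) (R : realType).
Variable mu : {measure set T -> \bar R}.
Hypothesis mu1 : mu setT = 1%E.
Variable coord : T -> R.
Hypothesis mcoord : measurable_fun setT coord.
Hypothesis coord1 : forall x, -1 <= coord x <= 1.
Variables (N : nat) (t eta : 'I_N -> R).
Hypothesis t0 : forall j, 0 <= t j.
Hypothesis tsum : \sum_j t j = 1.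
Hypothesis eta1 : forall j, `|eta j| < 1.
Hypothesis moments : forall k,
  (\int[mu]_x cheb k.+1 (coord x))%R = \sum_j t j * eta j ^+ k.+1.

(** The integral of ln (kern w s) against a law of s whose k-th Chebyshev moments
    are sum_j t_j eta_j^k; see [integral_ln_kern]. *)
Definition mixpot (w : R[i]) : R :=
  \sum_j t j * (2 * ln (normc (1 - (eta j)%:C%C * w))).

Let meas_cheb k : measurable_fun setT (fun x => cheb k (coord x)).
Proof.
by apply: measurableT_comp mcoord; exact: continuous_measurable_fun (@cheb_continuous _ _).
Qed.

Let meas_kern w : measurable_fun setT (fun x => kern w (coord x)).
Proof.
by apply: measurableT_comp mcoord; exact: continuous_measurable_fun (@kern_continuous _ _).
Qed.

Let series n w := \sum_(k < n) 2 * complex.Re (w ^+ k.+1) / k.+1%:R *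
   (\sum_j t j * eta j ^+ k.+1).

Let mixpot_series n w : normc w < 1 ->
  `|mixpot w + series n w| <= 2 * normc w ^+ n.+1 / (1 - normc w).
Proof.
move=> w1.
have -> : series n w = \sum_j t j *
    (2 * \sum_(k < n) complex.Re (((eta j)%:C%C * w) ^+ k.+1) / k.+1%:R).
  rewrite /series; under eq_bigr do rewrite mulr_sumr.
  rewrite exchange_big/=; apply: eq_bigr => j _.
  rewrite !mulr_sumr; apply: eq_bigr => k _.
  by rewrite exprMn -rmorphXn/= cReZ; ring.
rewrite /mixpot -big_split/=; apply: le_trans (ler_norm_sum _ _ _) _.
rewrite -[leRHS]mul1r -[X in X * _]tsum mulr_suml; apply: ler_sum => j _.
rewrite -mulrDr normrM ger0_norm//; apply: ler_wpM2l => //.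
rewrite -mulrDr normrM ger0_norm// -mulrA; apply: ler_wpM2l => //.
have le : normc ((eta j)%:C%C * w) <= normc w.
  by rewrite normcM normc_real ler_piMl ?normc_ge0// ltW.
apply: le_trans (ln_normc_series (le_lt_trans le w1) n) _.
apply: ler_pM; rewrite ?exprn_ge0 ?invr_ge0 ?normc_ge0 ?subr_ge0//.
- by rewrite (le_trans le)// ltW.
- by rewrite lerXn2r ?nnegrE ?normc_ge0.
- by rewrite lef_pV2 ?posrE ?subr_gt0 ?(le_lt_trans le)// lerB.
Qed.

Let kern_bound (w : R[i]) s : normc w < 1 -> -1 <= s <= 1 ->
  `|ln (kern w s)| <= 2 * normc w / (1 - normc w).
Proof.
by move=> w1 s1; have := ln_kern_series 0 w1 s1; rewrite big_ord0 addr0 expr1.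
Qed.

(** Both sides are within 2 |w|^(n+1) / (1 - |w|) of the same partial sum, for
    all n. *)
Lemma integral_ln_kern w : normc w < 1 ->
  (\int[mu]_x ln (kern w (coord x)))%R = mixpot w.
Proof.
move=> w1; apply/eqP; rewrite -subr_eq0; apply/eqP.
apply: (@geometric_bound_eq0 _ _ (4 * normc w / (1 - normc w)) (normc w)).
  by rewrite normc_ge0.
move=> n.
have ms : measurable_fun setT (fun x =>
    \sum_(k < n) 2 * complex.Re (w ^+ k.+1) / k.+1%:R * cheb k.+1 (coord x)).
  by apply: measurable_sum => k; exact: measurable_funM.
have ml : measurable_fun setT (fun x => ln (kern w (coord x))).
  by apply: measurableT_comp => //; exact: measurable_ln.
have e (x : T) : `|ln (kern w (coord x)) +
    \sum_(k < n) 2 * complex.Re (w ^+ k.+1) / k.+1%:R * cheb k.+1 (coord x)| <=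
    2 * normc w ^+ n.+1 / (1 - normc w).
  rewrite (eq_bigr (fun k : 'I_n =>
    2 * complex.Re (w ^+ k.+1) * cheb k.+1 (coord x) / k.+1%:R)).
    exact: ln_kern_series.
  by move=> k _; rewrite mulrAC.
have := le_norm_Rintegral mu1 (measurable_funD ml ms) e.
rewrite RintegralD//; first last.
- apply: (bounded_integrable mu1 
    (M := \sum_(k < n) `|2 * complex.Re (w ^+ k.+1) / k.+1%:R|)) => // x.
  apply: le_trans (ler_norm_sum _ _ _) _; apply: ler_sum => k _.
  by rewrite normrM ler_piMr// cheb_le1.
- by apply: (bounded_integrable mu1 ml) => x; exact: kern_bound.
rewrite (Rintegral_lin mu1 (f := fun k x => cheb k.+1 (coord x))
  (fun k => 2 * complex.Re (w ^+ k.+1) / k.+1%:R)) => [|//|k x]; last exact: cheb_le1.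
under eq_bigr do rewrite moments.
rewrite -/(series n w) => h1; have h2 := mixpot_series n w1.
set I := Rintegral _ _ _ in h1 *.
have -> : I - mixpot w = (I + series n w) - (mixpot w + series n w) by ring.
apply: le_trans (ler_normB _ _) _.
apply: le_trans (lerD h1 h2) _.
by rewrite le_eqVlt; apply/orP; left; apply/eqP; rewrite exprS; ring.
Qed.

Let r (n : nat) : R := 1 - n.+2%:R^-1.

Let r_bnd n : 2^-1 <= r n < 1.
Proof.
rewrite /r ltrBlDr ltrDl invr_gt0 ltr0n andbT lerBrDr -lerBrDl.
have -> : 1 - 2^-1 = 2%:R^-1 :> R by field.
by rewrite lef_pV2 ?posrE// ler_nat.
Qed.

Let r_gt0 n : 0 < r n.
Proof. by have /andP[h _] := r_bnd n; apply: lt_le_trans h; rewrite invr_gt0. Qed.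

Let r_nd n m : (n <= m)%N -> r n <= r m.
Proof. by move=> nm; rewrite lerB// lef_pV2 ?posrE// ler_nat !ltnS. Qed.

Let r_cvg : r n @[n --> \oo] --> (1 : R).
Proof.
rewrite -[X in _ --> X]subr0; apply: cvgB; first exact: cvg_cst.
by have := @cvg_harmonic R; rewrite -cvg_shiftS.
Qed.

Let mixpot_cvg w : normc w <= 1 -> mixpot ((r n)%:C%C * w) @[n --> \oo] --> mixpot w.
Proof.
move=> w1; apply: (cvg_big (op := +%R)) => [|j _]; first exact: add_continuous.
apply: cvgM; first exact: cvg_cst.
apply: cvgM; first exact: cvg_cst.
have pos : 0 < normc (1 - (eta j)%:C%C * w).
  have := ler_normcB 1 ((eta j)%:C%C * w); rewrite normc1; apply: lt_le_trans.
  rewrite subr_gt0 normcM normc_real (le_lt_trans _ (eta1 j))//.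
  by rewrite ler_piMr.
apply: (continuous_cvg _ (continuous_ln pos)).
apply: ccvg_normc; apply: ccvgD; first exact: ccvg_cst.
apply: ccvgN; apply: ccvgM; first exact: ccvg_cst.
rewrite -[X in ccvg _ _ X]mul1r; apply: ccvgM; last exact: ccvg_cst.
exact: ccvg_real.
Qed.

(** Replacing w by r w with r < 1 brings the previous lemma into play, and
    kern (r w) s / r decreases to kern w s as r increases to 1.  The factor 8
    makes the logarithms nonpositive, as kern is at most 4 and r at least 1/2. *)
Lemma integral_lne_kern w : normc w <= 1 ->
  mu.-integrable setT (fun x => lne (kern w (coord x))%:E) /\
  (\int[mu]_x lne (kern w (coord x))%:E = (mixpot w)%:E)%E.
Proof.
move=> w1.
have rw1 n : normc ((r n)%:C%C * w) < 1.
  rewrite normcM normc_real gtr0_norm//.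
  have /andP[_ h] := r_bnd n; apply: le_lt_trans h; rewrite ler_piMr// ltW//.
pose k n x := kern ((r n)%:C%C * w) (coord x) / (8 * r n).
have k0 n x : 0 < k n x by rewrite divr_gt0 ?kern_gt0// mulr_gt0.
have mk n : measurable_fun setT (k n) by apply: measurable_funM.
pose g n x := (- lne (k n x)%:E)%E.
have gE n x : g n x = (- ln (k n x))%:E by rewrite /g lne_EFin.
have mg n : measurable_fun setT (g n).
  apply: measurableT_comp => //; exact: (measurableT_comp (@lne_measurable R) (mk n)).
have g0 n x : setT x -> (0 <= g n x)%E.
  move=> _; rewrite gE lee_fin oppr_ge0; apply: ln_le0.
  rewrite ler_pdivrMr ?mulr_gt0// mul1r.
  have := kern_le4 (ltW (rw1 n)) (coord1 x); have /andP[+ _] := r_bnd n; lra.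
have g_nd x : setT x -> nondecreasing_seq (g^~ x).
  move=> _ n m nm; rewrite !gE lee_fin lerN2 ler_ln ?posrE// /k.
  have q01 : 0 <= r n / r m <= 1.
    apply/andP; split; first by apply: divr_ge0; apply: ltW.
    by rewrite ler_pdivrMr// mul1r r_nd.
  have := kern_radial q01 (ltW (rw1 m)) (coord1 x).
  rewrite mulrA -rmorphM/= divfK ?gt_eqF// => h.
  have -> : kern ((r m)%:C%C * w) (coord x) / (8 * r m) =
      r n / r m * kern ((r m)%:C%C * w) (coord x) / (8 * r n).
    by field; rewrite !gt_eqF.
  by rewrite ler_pM2r// invr_gt0 mulr_gt0.
have g_lim x : g n x @[n --> \oo] --> (- lne (kern w (coord x) / 8)%:E)%E.
  apply: cvgeN; apply: lne_cvg => //; last by rewrite divr_ge0 ?kern_ge0.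
  apply: cvgM; first exact: kern_scale_cvg.
  have c8 : 8 * r n @[n --> \oo] --> (8 : R).
    by rewrite -[X in _ --> X]mulr1; apply: cvgM; [exact: cvg_cst|].
  exact: cvgV.
pose L x := (- lne (kern w (coord x) / 8)%:E)%E.
have mL : measurable_fun setT L.
  apply: measurableT_comp => //.
  apply: (measurableT_comp (@lne_measurable R)).
  by apply: measurable_funM.
have L0 x : (0 <= L x)%E.
  rewrite /L oppe_ge0 lne_le0 lee_fin ler_pdivrMr// mul1r.
  by have := kern_le4 w1 (coord1 x); lra.
have ig n : (\int[mu]_x g n x = (ln (8 * r n) - mixpot ((r n)%:C%C * w))%:E)%E.
  under eq_integral do rewrite gE /k ln_div ?posrE ?kern_gt0 ?mulr_gt0// opprB EFinB.
  have li : mu.-integrable setT (EFin \o (fun x => ln (kern ((r n)%:C%C * w) (coord x)))).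
    apply: (bounded_integrable mu1 _ (fun x => kern_bound (rw1 n) (coord1 x))).
    by apply: measurableT_comp => //; exact: measurable_ln.
  rewrite integralB_EFin//; last first.
    exact: (bounded_integrable mu1 (M := `|ln (8 * r n)|)).
  rewrite integral_cst// mu1 mule1 EFinB; congr (_ - _)%E.
  by rewrite -integral_ln_kern// /Rintegral fineK// integrable_fin_num.
have lim1 : (\int[mu]_x g n x)%E @[n --> \oo] --> (\int[mu]_x L x)%E.
  rewrite (eq_integral (fun x => limn (g^~ x))); last first.
    by move=> x _; rewrite (cvg_lim _ (g_lim x)).
  by apply: cvg_monotone_convergence.
have lim2 : (\int[mu]_x g n x)%E @[n --> \oo] --> (ln 8 - mixpot w)%:E.
  under eq_fun do rewrite ig.
  apply: cvg_EFin; first exact: nearW.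
  apply: cvgB; last exact: mixpot_cvg.
  have l8 : {for (8 * 1 : R), continuous (@ln R)} by apply: continuous_ln; rewrite mulr1.
  rewrite -[X in ln X]mulr1; apply: (continuous_cvg _ l8).
  by apply: cvgM; [exact: cvg_cst|].
have iL : (\int[mu]_x L x = (ln 8 - mixpot w)%:E)%E by exact: cvg_unique lim1 lim2.
have Lint : mu.-integrable setT L.
  apply/integrableP; split => //.
  by under eq_integral do rewrite gee0_abs//; rewrite iL ltry.
have -> : (fun x => lne (kern w (coord x))%:E) = (cst (ln 8)%:E \- L)%E.
  apply/funext => x.
  rewrite -[RHS]/((ln 8)%:E - - lne (kern w (coord x) / 8)%:E)%E.
  have := kern_ge0 w (coord x); rewrite le_eqVlt => /predU1P[<-|kp].
    by rewrite mul0r /lne lexx.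
  rewrite !lne_EFin ?divr_gt0// ln_div ?posrE//.
  by rewrite -!EFinN -EFinD; congr (_%:E); ring.
have cint : mu.-integrable setT (cst (ln 8)%:E).
  exact: (bounded_integrable mu1 (f := cst (ln 8)) (M := `|ln 8|)).
split; first exact: integrableB.
rewrite integralB//.
by rewrite iL integral_cst// mu1 mule1 -EFinB; congr (_%:E); ring.
Qed.

End potential.

(** * Minimum of a mixture of Green functions *)

Section radial_concave.
Variable R : realType.

Lemma ln_conv (l a b : R) : 0 <= l <= 1 -> 0 < a -> 0 < b ->
  l * ln a + (1 - l) * ln b <= ln (l * a + (1 - l) * b).
Proof.
move=> l01 a0 b0; have /andP[l0 l1] := l01.
have := @concave_ln R (Itv01 l0 l1) a b a0 b0.
by rewrite !convRE.
Qed.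

(** With e = w / |w| and l = (1 + Re e) / 2, the claim reduces by concavity
    of ln to |1 - eta e|^2 <= |1 - eta w|^2 / |w|, and the difference of these two
    is (1 - |w|) (1 - eta^2 |w|) / |w|. *)
Lemma weighted_green_ge (eta l : R) (w : R[i]) : `|eta| < 1 -> w != 0 -> normc w <= 1 ->
  l = (1 + complex.Re w / normc w) / 2 ->
  l * (2 * ln (1 - eta)) + (1 - l) * (2 * ln (1 + eta)) <=
  2 * ln (normc (1 - eta%:C%C * w)) - ln (normc w).
Proof.
move=> eta1 w0 w1 lE.
have [e1 e2] : 0 < 1 - eta /\ 0 < 1 + eta.
  by move: eta1; rewrite ltr_norml => /andP[]; lra.
have n0 : 0 < normc w by rewrite normc_gt0.
have xb : `|complex.Re w / normc w| <= 1.
  by rewrite normrM normfV (gtr0_norm n0) ler_pdivrMr// mul1r Re_le_normc.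
have l01 : 0 <= l <= 1 by move: xb; rewrite ler_norml lE => /andP[]; lra.
have pos : 0 < normc (1 - eta%:C%C * w).
  have := ler_normcB 1 (eta%:C%C * w); rewrite normc1; apply: lt_le_trans.
  by rewrite subr_gt0 normcM normc_real (le_lt_trans _ eta1)// ler_piMr.
have ln2 (x : R) : 0 < x -> 2 * ln x = ln (x ^+ 2).
  by move=> x0; rewrite expr2 lnM ?posrE//; ring.
rewrite !ln2// -ln_div ?posrE ?exprn_gt0//.
apply: le_trans (ln_conv l01 _ _) _; rewrite ?exprn_gt0//.
rewrite ler_ln ?posrE ?divr_gt0 ?exprn_gt0//; last first.
  have [h|h] := leP l (1/2).
    by apply: ltr_wpDl; [apply: mulr_ge0|apply: mulr_gt0]; rewrite ?exprn_ge0 ?exprn_gt0//; lra.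
  by apply: ltr_pwDl; [apply: mulr_gt0|apply: mulr_ge0]; rewrite ?exprn_ge0 ?exprn_gt0//; lra.
rewrite ler_pdivlMr//.
have -> : (l * (1 - eta) ^+ 2 + (1 - l) * (1 + eta) ^+ 2) * normc w =
   (1 + eta ^+ 2) * normc w - 2 * eta * complex.Re w.
  by rewrite lE; field; rewrite gt_eqF.
have -> : normc (1 - eta%:C%C * w) ^+ 2 =
    1 - 2 * eta * complex.Re w + eta ^+ 2 * normc w ^+ 2.
  by rewrite !normc_sqr; case: (w) => x y /=; ring.
have : eta ^+ 2 <= 1 by rewrite -real_normK ?num_real// expr_le1// ltW.
move=> h.
have : 0 <= (1 - normc w) * (1 - eta ^+ 2 * normc w).
  by apply: mulr_ge0; rewrite subr_ge0// mulr_ile1// ?sqr_ge0// ltW.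
lra.
Qed.

(** The weight l of [weighted_green_ge] does not depend on eta, so that
    averaging over eta bounds the left-hand side from below by a convex combination
    of its values at w = 1 and w = -1. *)
Lemma mixpot_lower (N : nat) (t eta : 'I_N -> R) (w : R[i]) (c : R) :
  (forall j, 0 <= t j) -> \sum_j t j = 1 -> (forall j, `|eta j| < 1) ->
  w != 0 -> normc w <= 1 ->
  0 <= c + mixpot t eta 1 -> 0 <= c + mixpot t eta (-1) ->
  0 <= c + mixpot t eta w - ln (normc w).
Proof.
move=> t0 tsum eta1 w0 w1 h1 h2.
set l := (1 + complex.Re w / normc w) / 2.
have n0 : 0 < normc w by rewrite normc_gt0.
have xb : `|complex.Re w / normc w| <= 1.
  by rewrite normrM normfV (gtr0_norm n0) ler_pdivrMr// mul1r Re_le_normc.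
have l01 : 0 <= l <= 1 by move: xb; rewrite ler_norml /l => /andP[]; lra.
have key : l * mixpot t eta 1 + (1 - l) * mixpot t eta (-1) <=
    mixpot t eta w - ln (normc w).
  have -> : mixpot t eta 1 = \sum_j t j * (2 * ln (1 - eta j)).
    apply: eq_bigr => j _.
    rewrite mulr1 -(rmorph1 (real_complex R)) -rmorphB normc_real gtr0_norm//.
    by have := eta1 j; rewrite ltr_norml => /andP[]; lra.
  have -> : mixpot t eta (-1) = \sum_j t j * (2 * ln (1 + eta j)).
    apply: eq_bigr => j _.
    rewrite mulrN1 opprK -(rmorph1 (real_complex R)) -rmorphD normc_real gtr0_norm//.
    by have := eta1 j; rewrite ltr_norml => /andP[]; lra.
  rewrite -[ln (normc w)]mul1r -[X in X * ln _]tsum /mixpot.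
  rewrite mulr_suml -sumrB !mulr_sumr -big_split.
  apply: ler_sum => j _.
  have := ler_wpM2l (t0 j) (weighted_green_ge (eta1 j) w0 w1 (erefl l)).
  move: (ln (normc (1 - _))) (ln (normc w)) => X Y /=; lra.
have /andP[l0 l1] := l01.
have := mulr_ge0 l0 h1.
have : 0 <= (1 - l) * (c + mixpot t eta (-1)) by rewrite mulr_ge0// subr_ge0.
lra.
Qed.

End radial_concave.

(** * Complex differentiability and harmonicity *)

Section complex_diff.
Variable R : realType.
Implicit Types (f g : plane R -> R[i]) (p q : plane R) (O : set (plane R)).

(** The directions 1 and i of the two partial derivatives. *)
Definition axisC (i : bool) : R[i] := toC (axis R i).

Definition ccont f p := ccvg (nbhs p) f (f p).

(** Only increments along the two axes enter: this is all that partial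
    derivatives see, and the factor [axisC i] encodes the Cauchy-Riemann
    equations. *)
Definition cdiff f p (d : R[i]) := forall i,
  ccvg (0^') (fun h : R => (h^-1)%:C%C * (f (h *: axis R i + p) - f p)) (axisC i * d).

Lemma axis_cvg p i : (h *: axis R i + p) @[h --> (0 : R)^'] --> p.
Proof.
have : {for (0 : R), continuous (fun h : R => h *: axis R i + p)}.
  apply: cvgD; last exact: cvg_cst.
  by apply: cvgZr_tmp; exact: cvg_id.
rewrite /prop_for /continuous_at scale0r add0r => c.
exact: cvg_within_filter c.
Qed.

Lemma ccont_axis f p i : ccont f p ->
  ccvg (0^') (fun h : R => f (h *: axis R i + p)) (f p).
Proof.
move=> [fr fi]; have l := @axis_cvg p i; split.
  exact: (cvg_comp _ _ l fr).
exact: (cvg_comp _ _ l fi).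
Qed.

Lemma ccvg_eq (F : set_system R) (f g : R -> R[i]) l : f =1 g -> ccvg F f l -> ccvg F g l.
Proof. by move=> /funext ->. Qed.

Lemma cdiffM f g p df dg : ccont f p -> ccont g p -> cdiff f p df -> cdiff g p dg ->
  cdiff (fun q => f q * g q) p (df * g p + f p * dg).
Proof.
move=> cf cg f1 g1 i.
have -> : axisC i * (df * g p + f p * dg) = (axisC i * df) * g p + f p * (axisC i * dg) by ring.
apply: (ccvg_eq _ (ccvgD (ccvgM (f1 i) (ccont_axis i cg)) (ccvgM (ccvg_cst (f p)) (g1 i)))).
by move=> h; ring.
Qed.

Lemma cdiffD f g p df dg : cdiff f p df -> cdiff g p dg ->
  cdiff (fun q => f q + g q) p (df + dg).
Proof.
move=> f1 g1 i; rewrite mulrDr.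
by apply: (ccvg_eq _ (ccvgD (f1 i) (g1 i))) => h; ring.
Qed.

Lemma cdiff_cst (c : R[i]) p : cdiff (fun=> c) p 0.
Proof.
move=> i; rewrite mulr0.
by apply: (ccvg_eq _ (ccvg_cst (0 : R[i]))) => h; ring.
Qed.

Lemma cdiffV f p df : (forall q, f q != 0) -> ccont f p -> cdiff f p df ->
  cdiff (fun q => (f q)^-1) p (- df / (f p) ^+ 2).
Proof.
move=> f0 cf f1 i.
have -> : axisC i * (- df / f p ^+ 2) = (axisC i * df) * (- (f p)^-1 * (f p)^-1).
  by rewrite expr2 invfM; ring.
apply: (ccvg_eq _ (ccvgM (f1 i) 
  (ccvgM (ccvgN (ccvgV (f0 p) (ccont_axis i cf))) (ccvg_cst (f p)^-1)))).
by move=> h; move: (h^-1)%:C%C => k; field; rewrite !f0.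
Qed.

(** f1 is the derivative of f on O, and is continuous there. *)
Definition holo O f f1 := forall p, O p ->
  [/\ ccont f p, ccont f1 p & cdiff f p (f1 p)].

Lemma holoM O f g f1 g1 : holo O f f1 -> holo O g g1 ->
  holo O (fun q => f q * g q) (fun q => f1 q * g q + f q * g1 q).
Proof.
move=> hf hg p Op; have [cf cf1 df] := hf p Op; have [cg cg1 dg] := hg p Op.
split; [exact: ccvgM| |exact: cdiffM].
by apply: ccvgD; exact: ccvgM.
Qed.

Lemma holoD O f g f1 g1 : holo O f f1 -> holo O g g1 ->
  holo O (fun q => f q + g q) (fun q => f1 q + g1 q).
Proof.
move=> hf hg p Op; have [cf cf1 df] := hf p Op; have [cg cg1 dg] := hg p Op.
by split; [exact: ccvgD|exact: ccvgD|exact: cdiffD].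
Qed.

Lemma holo_cst O c : holo O (fun=> c) (fun=> 0).
Proof. by move=> p Op; split; [exact: ccvg_cst|exact: ccvg_cst|exact: cdiff_cst]. Qed.

Lemma holoV O f f1 : (forall q, f q != 0) -> holo O f f1 ->
  holo O (fun q => (f q)^-1) (fun q => - f1 q / (f q) ^+ 2).
Proof.
move=> f0 hf p Op; have [cf cf1 df] := hf p Op.
split; [exact: ccvgV| |exact: cdiffV].
apply: ccvgM; first exact: ccvgN.
by apply: ccvgV; [rewrite expf_neq0|exact: ccvgX].
Qed.

Definition holo2 O f := exists f1 f2, holo O f f1 /\ holo O f1 f2.

Lemma holo2M O f g : holo2 O f -> holo2 O g -> holo2 O (fun q => f q * g q).
Proof.
move=> [f1 [f2 [hf hf1]]] [g1 [g2 [hg hg1]]].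
eexists; eexists; split; first exact: holoM hf hg.
exact: holoD (holoM hf1 hg) (holoM hf hg1).
Qed.

Lemma holo2X O f n : holo2 O f -> holo2 O (fun q => f q ^+ n).
Proof.
move=> hf; elim: n => [|n ih].
  by exists (fun=> 0), (fun=> 0); split; exact: holo_cst.
have -> : (fun q => f q ^+ n.+1) = (fun q => f q * f q ^+ n).
  by apply/funext => q; rewrite exprS.
exact: holo2M.
Qed.

Lemma cdiff_Re f p d (c : R[i]) i : cdiff f p d ->
  is_derive p (axis R i) (fun q => complex.Re (c * f q) : R) (complex.Re (c * (axisC i * d))).
Proof.
move=> f1; have [fr _] := ccvgM (ccvg_cst c) (f1 i).
have e : (fun h : R => h^-1 *: (((fun q => complex.Re (c * f q) : R) \o shift p) (h *: axis R i) -
     complex.Re (c * f p))) =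
   (fun h : R => complex.Re (c * ((h^-1)%:C%C * (f (h *: axis R i + p) - f p)))).
  apply/funext => h; rewrite /=.
  move: (f (h *: axis R i + p)) (f p) => [u1 u2] [v1 v2]; case: (c) => c1 c2.
  by rewrite /GRing.scale/=; ring.
split; first by rewrite /derivable e; apply: cvgP fr.
by rewrite /derive e; apply: cvg_lim.
Qed.

(** With g the second derivative of f, the partial derivatives in the directions
    i and j of Re f are the real parts of axisC i * axisC j * g, and 1^2 + i^2 = 0. *)
Lemma holo2_harmonic O f p : open O -> holo2 O f -> O p ->
  harmonic_at (fun q => complex.Re (f q)) p.
Proof.
move=> oO [f1 [f2 [hf hf1]]] Op.
have Re1 (g : plane R -> R[i]) : (fun q => complex.Re (g q)) = (fun q => complex.Re (1 * g q)).
  by apply/funext => q; rewrite mul1r.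
have D1 i q : O q -> 'D_(axis R i) (fun q => complex.Re (f q)) q = complex.Re (axisC i * f1 q).
  move=> Oq; have [_ _ d] := hf q Oq; rewrite Re1 (@derive_val _ _ _ _ _ _ _ (cdiff_Re 1 i d)).
  by rewrite mul1r.
have near_O q : O q -> \forall q' \near q, O q' by move=> Oq; apply: open_nbhs_nbhs.
have ID2 i j q : O q -> is_derive q (axis R j) ('D_(axis R i) (fun q => complex.Re (f q)))
    (complex.Re (axisC i * (axisC j * f2 q))).
  move=> Oq; have [_ _ d] := hf1 q Oq.
  apply: near_eq_is_derive (cdiff_Re (axisC i) j d).
  have nO := near_O q Oq; by near=> q'; rewrite D1//; near: q'.
have D2 i j q : O q -> 'D_(axis R j) ('D_(axis R i) (fun q => complex.Re (f q))) q =
    complex.Re (axisC i * (axisC j * f2 q)).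
  by move=> Oq; rewrite (@derive_val _ _ _ _ _ _ _ (ID2 i j q Oq)).
have nO := near_O p Op; near=> q; have Oq : O q by near: q.
have [cf cf1 d1] := hf q Oq; have [_ cf2 d2] := hf1 q Oq.
split.
- by move=> i; rewrite Re1; have [] := cdiff_Re 1 i d1.
- by move=> i j; have [] := ID2 i j q Oq.
- move=> i j; rewrite /prop_for /continuous_at D2//.
  have [c _] := ccvgM (ccvg_cst (axisC i)) (ccvgM (ccvg_cst (axisC j)) cf2).
  apply: cvg_trans c; apply: near_eq_cvg.
  have nOq := near_O q Oq; by near=> q'; rewrite D2//; near: q'.
- rewrite !D2// /axisC/=; case: (f2 q) => x y /=; ring.
Unshelve. all: by end_near. Qed.

End complex_diff.

(** * Differentiability of implicitly defined maps *)

Section implicit.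
Variable R : realType.

Lemma toC_cvg (p : plane R) : ccvg (nbhs p) (@toC R) (toC p).
Proof. by split; [exact: cvg_fst|exact: cvg_snd]. Qed.

Lemma toCB (p q : plane R) : toC (p - q) = toC p - toC q.
Proof. by []. Qed.

Lemma toC_axis (p : plane R) h i : toC (h *: axis R i + p) - toC p = h%:C%C * axisC R i.
Proof.
by rewrite -toCB addrK; case: i; apply/eqP; rewrite eq_complex/= /GRing.scale/=;
   apply/andP; split; apply/eqP; ring.
Qed.

Lemma ccvg_near_eq (F : set_system R) {FF : Filter F} (f g : R -> R[i]) l :
  (\forall x \near F, f x = g x) -> ccvg F f l -> ccvg F g l.
Proof.
move=> fg [fr fi]; split; [apply: cvg_trans fr|apply: cvg_trans fi];
  by apply: near_eq_cvg; near=> x; congr (_ _); near: x.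
Unshelve. all: by end_near. Qed.

Variables (O : set (plane R)) (w : plane R -> R[i]) (kap e0 e1 e2 : R[i]).
Hypothesis oO : open O.
Hypothesis w1 : forall p, normc (w p) < 1.
Let E p := e0 + (e1 * w p + e2 * (w p * w p)).
Hypothesis wE : forall p q, O p -> O q ->
  (w p - w q) * (1 - w p * w q) = kap * (toC p - toC q) * (E p * E q).

Let ww1 p q : normc (w p * w q) < 1.
Proof.
rewrite normcM; apply: le_lt_trans (w1 p).
by rewrite ler_piMr ?normc_ge0// ltW.
Qed.

Let ww0 p q : 1 - w p * w q != 0.
Proof.
rewrite -normc_gt0; apply: lt_le_trans (ler_normcB _ _).
by rewrite normc1 subr_gt0.
Qed.

Let nearO p : O p -> \forall q \near p, O q.
Proof. by move=> Op; apply: open_nbhs_nbhs. Qed.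

Let w_cont p : O p -> ccont w p.
Proof.
move=> Op; pose M := normc e0 + (normc e1 + normc e2).
have EM q : normc (E q) <= M.
  have wl : normc (w q) <= 1 by rewrite ltW.
  apply: le_trans (le_normcD _ _) (lerD _ _) => //.
  apply: le_trans (le_normcD _ _) (lerD _ _); rewrite normcM.
    by rewrite ler_piMr ?normc_ge0.
  by rewrite ler_piMr ?normc_ge0// ltW.
have M0 : 0 <= M by rewrite !addr_ge0 ?normc_ge0.
have d0 : 0 < 1 - normc (w p) by rewrite subr_gt0.
(* the Lipschitz constant of w at p *)
pose c := normc kap * (M * M) / (1 - normc (w p)).
apply: (@ccvg_squeeze _ _ _ _ _ _ (fun q => c * normc (toC q - toC p))).
  have nO := nearO Op; near=> q.
  have Oq : O q by near: q.
  rewrite /c mulrAC ler_pdivlMr//.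
  have := congr1 (@normc R) (wE Oq Op); rewrite !normcM.
  have h1 : 1 - normc (w p) <= normc (1 - w q * w p).
    apply: le_trans (ler_normcB _ _); rewrite normc1 lerB// normcM.
    by rewrite ler_piMl ?normc_ge0// ltW.
  move=> h2; apply: le_trans (ler_wpM2l (normc_ge0 _) h1) _.
  rewrite h2 [leRHS]mulrAC; apply: ler_wpM2l; first by rewrite mulr_ge0 ?normc_ge0.
  by apply: ler_pM; rewrite ?normc_ge0.
have tc : normc (toC q - toC p) @[q --> p] --> normc (toC p - toC p).
  by apply: ccvg_normc; apply: ccvgD; [exact: toC_cvg|exact: ccvg_cst].
rewrite -[X in _ --> X](mulr0 c); apply: cvgM; first exact: cvg_cst.
by move: tc; rewrite subrr normc0.
Unshelve. all: by end_near. Qed.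

Let dw p := kap * (E p * E p) * (1 + (-1) * (w p * w p))^-1.

Let E_cont p : O p -> ccont E p.
Proof.
move=> /w_cont c; apply: ccvgD; first exact: ccvg_cst.
by apply: ccvgD; apply: ccvgM; try exact: ccvg_cst; [|exact: ccvgM].
Qed.

Let w_holo : holo O w dw.
Proof.
move=> p Op; have c := w_cont Op; have cE := E_cont Op.
have e q : 1 + (-1) * (w q * w q) = 1 - w q * w q by rewrite mulN1r.
split => //.
  apply: ccvgM; first by apply: ccvgM; [exact: ccvg_cst|exact: ccvgM].
  apply: ccvgV; first by rewrite e.
  apply: ccvgD; first exact: ccvg_cst.
  by apply: ccvgM; [exact: ccvg_cst|exact: ccvgM].
move=> i.
have -> : axisC R i * dw p = kap * axisC R i * (E p * E p) * (1 - w p * w p)^-1.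
  by rewrite /dw e; ring.
have cl := ccont_axis i c; have cEl := ccont_axis i cE.
apply: (ccvg_near_eq (f := fun h => kap * axisC R i * (E (h *: axis R i + p) * E p) *
    (1 - w (h *: axis R i + p) * w p)^-1)).
  have nO : \forall h \near (0 : R)^', O (h *: axis R i + p).
    exact: (@axis_cvg R p i _ (nearO Op)).
  near=> h.
  have h0 : h != 0 by near: h; exact: nbhs_dnbhs_neq.
  have Oq : O (h *: axis R i + p) by near: h.
  set q := h *: axis R i + p in Oq *.
  have -> : w q - w p = kap * (toC q - toC p) * (E q * E p) * (1 - w q * w p)^-1.
    by rewrite -wE// mulfK.
  rewrite toC_axis fmorphV.
  by field; rewrite ww0 fmorph_eq0.
apply: ccvgM.
  by apply: ccvgM; [exact: ccvg_cst|apply: ccvgM => //; exact: ccvg_cst].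
apply: ccvgV => //; apply: ccvgD; first exact: ccvg_cst.
by apply: ccvgN; apply: ccvgM => //; exact: ccvg_cst.
Unshelve. all: by end_near. Qed.

(** As |w| < 1, the relation between differences makes w locally Lipschitz, hence
    continuous; dividing by the increment then gives the derivative
    kap E^2 / (1 - w^2), a rational function of w, which can be differentiated
    again.  Both charts of the sphere lead to a relation of this form. *)
Lemma implicit_holo2 : holo2 O w.
Proof.
have hE := holoD (@holo_cst R O e0) (holoD (holoM (@holo_cst R O e1) w_holo)
  (holoM (@holo_cst R O e2) (holoM w_holo w_holo))).
have hD := holoD (@holo_cst R O 1) (holoM (@holo_cst R O (-1)) (holoM w_holo w_holo)).
exists dw; eexists; split; first exact: w_holo.
apply: (holoM (holoM (@holo_cst R O kap) (holoM hE hE)) (holoV _ hD)) => q /=.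
by rewrite mulN1r.
Qed.

End implicit.

(** * The conformal map from the exterior of the segment to the disc *)

Section exterior.
Variable R : realType.
Variables a b : R.
Hypothesis hab : a < b.

Definition midpt : R := (a + b) / 2.
Definition halflen : R := (b - a) / 2.

Lemma halflen_gt0 : 0 < halflen. Proof. by rewrite /halflen divr_gt0// subr_gt0. Qed.

(** The complex coordinate in which the segment becomes [-1, 1]. *)
Definition affine_coord (p : plane R) : R[i] := (toC p - midpt%:C%C) / halflen%:C%C.

Let hC0 : halflen%:C%C != 0 :> R[i].
Proof. by rewrite fmorph_eq0 gt_eqF// halflen_gt0. Qed.

Lemma affine_coord_real (x : R) : affine_coord (real_pt x) = ((x - midpt) / halflen)%:C%C.
Proof.
by rewrite /affine_coord -[toC (real_pt x)]/(x%:C%C) -rmorphB -fmorphV -rmorphM.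
Qed.

Lemma itv_affine_coord (x : R) : (a <= x <= b) = (-1 <= (x - midpt) / halflen <= 1).
Proof.
have h0 := halflen_gt0; rewrite ler_pdivlMr// ler_pdivrMr// /midpt /halflen.
by apply/idP/idP => /andP[h1 h2]; apply/andP; split; lra.
Qed.

Lemma real_segmentP (p : plane R) : real_segment a b p <->
  exists2 s : R, -1 <= s <= 1 & affine_coord p = s%:C%C.
Proof.
split=> [[x /=]|[s s1 e]].
  rewrite in_itv/= itv_affine_coord => xab <-.
  by exists ((x - midpt) / halflen); rewrite ?affine_coord_real.
have h0 := halflen_gt0.
have : toC p = midpt%:C%C + halflen%:C%C * s%:C%C.
  by rewrite -e /affine_coord mulrC mulfVK// addrC subrK.
case: p e => x y _ [xE yE]; exists x; last first.
  by rewrite /real_pt yE; congr (_, _); ring.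
rewrite /= in_itv/= itv_affine_coord xE mul0r subr0 [midpt + _]addrC addrK mulrAC mulfV ?mul1r//.
by rewrite gt_eqF.
Qed.

(** If the preimage of the affine coordinate of p under [jouk] has modulus 1, then
    that coordinate is real and in [-1, 1]. *)
Lemma disc_coord_exists p : exists w : R[i], normc w < 1 /\
  (~ real_segment a b p -> w != 0 /\ affine_coord p = jouk w).
Proof.
have [w [w0 w1 e]] := jouk_surj (affine_coord p).
have [wl|wg] := ltP (normc w) 1; first by exists w.
exists 0; rewrite normc0; split=> //; case; apply/real_segmentP.
have w1' : normc w = 1 by apply/eqP; rewrite eq_le w1.
exists (complex.Re w); last by rewrite e jouk_unit.
by have := Re_le_normc w; rewrite w1' ler_norml.
Qed.

(** The inverse of the Joukowski map on the exterior of the segment; its value on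
    the segment is only required to have modulus less than 1. *)
Definition disc_coord p : R[i] := projT1 (cid (disc_coord_exists p)).

Lemma disc_coord_lt1 p : normc (disc_coord p) < 1.
Proof. by rewrite /disc_coord; case: cid => w []. Qed.

Lemma disc_coord_jouk p : ~ real_segment a b p ->
  disc_coord p != 0 /\ affine_coord p = jouk (disc_coord p).
Proof. by rewrite /disc_coord; case: cid => w []. Qed.

Let C2 : (2 : R[i]) != 0. Proof. by rewrite pnatr_eq0. Qed.

Lemma disc_coord_sub p q : ~ real_segment a b p -> ~ real_segment a b q ->
  (disc_coord p - disc_coord q) * (1 - disc_coord p * disc_coord q) =
  (- (2 / halflen%:C%C)) * (toC p - toC q) * (disc_coord p * disc_coord q).
Proof.
move=> /disc_coord_jouk[p0 pE] /disc_coord_jouk[q0 qE].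
have e : jouk (disc_coord p) - jouk (disc_coord q) = (toC p - toC q) / halflen%:C%C.
  by rewrite -pE -qE /affine_coord -mulrBl; congr (_ / _); ring.
rewrite -[1 - _]opprB mulrN jouk_sub// e; ring.
Qed.

Lemma real_segment_closed : closed (real_segment a b).
Proof.
have -> : real_segment a b =
    [set p : plane R | a <= p.1] `&` [set p | p.1 <= b] `&` [set p | p.2 = 0].
  apply/seteqP; split=> [_ [x + <-]|[x y] [[/= h1 h2] h3]].
    by rewrite /= in_itv/= => /andP[].
  by exists x; rewrite ?h3//= in_itv/= h1.
have c1 : continuous (fst : plane R -> R) by move=> p; exact: cvg_fst.
have c2 : continuous (snd : plane R -> R) by move=> p; exact: cvg_snd.
apply: closedI; first apply: closedI.
- exact: (closed_comp (fun p _ => c1 p) (@closed_ge R a)).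
- exact: (closed_comp (fun p _ => c1 p) (@closed_le R b)).
- exact: (closed_comp (fun p _ => c2 p) (@closed_eq R 0)).
Qed.

Lemma disc_coord_holo2 : holo2 (~` real_segment a b) disc_coord.
Proof.
apply: (@implicit_holo2 R _ disc_coord (- (2 / halflen%:C%C)) 0 1 0).
- exact/closed_openC/real_segment_closed.
- exact: disc_coord_lt1.
- by move=> p q Op Oq; rewrite disc_coord_sub// !mul0r !addr0 !add0r !mul1r.
Qed.

Definition plane_inv (v : plane R) : plane R := (complex.Re (toC v)^-1, complex.Im (toC v)^-1).
(** [disc_coord] read in the chart at infinity, which it maps to 0. *)
Definition disc_coord_infty (v : plane R) : R[i] := if v == 0 then 0 else disc_coord (plane_inv v).

Lemma toC_inv v : toC (plane_inv v) = (toC v)^-1.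
Proof. by rewrite /plane_inv /toC /=. Qed.

Lemma toC_eq0 (v : plane R) : (toC v == 0) = (v == 0).
Proof. by case: v => x y; rewrite eq_complex /= xpair_eqE. Qed.

Definition near_infty : set (plane R) :=
  [set v | normc (toC v) < (`|a| + `|b| + 1)^-1].

Lemma near_infty_open : open near_infty.
Proof.
apply: (open_comp _ (@open_lt R _)) => v _.
exact: (ccvg_normc (toC_cvg v)).
Qed.

Lemma near_infty_segment v : near_infty v -> v != 0 -> ~ real_segment a b (plane_inv v).
Proof.
move=> vn v0 [x /=]; rewrite in_itv/= => /andP[ax xb] e.
have := congr1 (fun p => normc (toC p)) e; rewrite toC_inv normcV.
rewrite -[toC (real_pt x)]/(x%:C%C) normc_real => e2.
have n0 : 0 < normc (toC v) by rewrite normc_gt0 toC_eq0.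
have M0 : 0 < `|a| + `|b| + 1 by rewrite ltr_wpDl// addr_ge0.
have : `|a| + `|b| + 1 < `|x|.
  by rewrite e2 -[ltLHS]invrK ltf_pV2 ?posrE// invr_gt0.
have : `|x| <= `|a| + `|b|.
  have := ler_norm a; have := ler_norm b; have := ler_norm (-a); have := ler_norm (-b).
  by rewrite !normrN ler_norml => *; apply/andP; split; lra.
lra.
Qed.

Let Dd (z : R[i]) := halflen%:C%C + (2 * midpt%:C%C * z + halflen%:C%C * (z * z)).

(** Clearing denominators in 1 / v = midpt + halflen * J(w) gives an equation that
    persists at v = w = 0. *)
Let disc_coord_inftyE v : near_infty v -> toC v * Dd (disc_coord_infty v) = 2 * disc_coord_infty v.
Proof.
move=> vn; rewrite /disc_coord_infty; case: eqVneq => [->|v0].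
  by rewrite !mulr0 (_ : toC 0 = 0)// mul0r.
have [p0 pE] := disc_coord_jouk (near_infty_segment vn v0).
have tv : toC v != 0 by rewrite toC_eq0.
have e : (toC v)^-1 = midpt%:C%C + halflen%:C%C * jouk (disc_coord (plane_inv v)).
  by rewrite -pE /affine_coord toC_inv mulrC mulfVK//; ring.
set z := disc_coord _ in p0 e *; move: e.
have -> : midpt%:C%C + halflen%:C%C * jouk z = Dd z / (2 * z).
  by rewrite /Dd /jouk; field.
move=> e; have := congr1 (fun x => toC v * x * (2 * z)) e => /=.
rewrite mulfV// mul1r => ->.
by rewrite -!mulrA mulVf ?mulr1// mulf_neq0.
Qed.

Lemma disc_coord_infty_lt1 v : normc (disc_coord_infty v) < 1.
Proof. by rewrite /disc_coord_infty; case: ifP => _; rewrite ?disc_coord_lt1// normc0. Qed.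

Lemma disc_coord_infty_holo2 : holo2 near_infty disc_coord_infty.
Proof.
apply: (@implicit_holo2 R _ disc_coord_infty
  ((2 * halflen%:C%C)^-1) halflen%:C%C (2 * midpt%:C%C) halflen%:C%C).
- exact: near_infty_open.
- exact: disc_coord_infty_lt1.
- move=> p q Op Oq; rewrite -/(Dd (disc_coord_infty p)) -/(Dd (disc_coord_infty q)).
  have hp := disc_coord_inftyE Op; have hq := disc_coord_inftyE Oq.
  set u := disc_coord_infty p in hp *; set v := disc_coord_infty q in hq *.
  have e : 2 * halflen%:C%C * ((u - v) * (1 - u * v)) = (2 * u) * Dd v - (2 * v) * Dd u.
    by rewrite /Dd; ring.
  rewrite -[LHS](mulKf (mulf_neq0 C2 hC0)) e -hp -hq; ring.
Qed.

(** Re w^k, the solution of the Dirichlet problem with boundary values T_k. *)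
Definition power_sol (k : nat) (x : sphere R) : R :=
  if x is Some p then complex.Re (disc_coord p ^+ k) else complex.Re ((0 : R[i]) ^+ k).

Lemma power_sol_harmonic k (Om : set (sphere R)) :
  Om `<=` ~` (@fin_pt R @` real_segment a b) -> harmonic_on Om (power_sol k).
Proof.
move=> OmK; split=> [z /OmK zK|_].
  apply: (holo2_harmonic (f := fun q => disc_coord q ^+ k) (O := ~` real_segment a b)).
  - exact/closed_openC/real_segment_closed.
  - exact/holo2X/disc_coord_holo2.
  - by move=> zs; apply: zK; exists z.
have -> : power_sol k \o @chart_infty R = (fun q => complex.Re (disc_coord_infty q ^+ k)).
  by apply/funext => v; rewrite /= /chart_infty /disc_coord_infty; case: ifP.
apply: (holo2_harmonic (O := near_infty)).
- exact: near_infty_open.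
- exact/holo2X/disc_coord_infty_holo2.
- rewrite /near_infty /mkset (_ : toC 0 = 0)// normc0 invr_gt0.
  by rewrite ltr_wpDl// addr_ge0.
Qed.

Lemma power_sol_bounded k x : `|power_sol k x| <= 1.
Proof.
case: x => [p|] /=; apply: le_trans (Re_le_normc _) _; rewrite normcX.
  by rewrite exprn_ile1 ?normc_ge0// ltW// disc_coord_lt1.
by rewrite normc0 exprn_ile1.
Qed.

End exterior.

(** * Boundary behaviour *)

Section boundary.
Variable R : realType.

Lemma normc_pow_sub (z c : R[i]) k : normc z <= 1 -> normc c <= 1 ->
  normc (z ^+ k - c ^+ k) <= k%:R * normc (z - c).
Proof.
move=> z1 c1; elim: k => [|k ih]; first by rewrite !expr0 subrr normc0 mul0r.
have -> : z ^+ k.+1 - c ^+ k.+1 = z * (z ^+ k - c ^+ k) + (z - c) * c ^+ k.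
  by rewrite !exprS; ring.
apply: le_trans (le_normcD _ _) _; rewrite !normcM -natr1 mulrDl mul1r; apply: lerD.
  by apply: le_trans ih; rewrite ler_piMl ?normc_ge0.
by rewrite ler_piMr ?normc_ge0// normcX exprn_ile1 ?normc_ge0.
Qed.

(** With c = e^{i theta}, c' its conjugate and s = cos theta, one has
    (w - c) (w - c') = 2 w (J(w) - s), so one of the two factors is at most the
    square root; and c^k and c'^k have the same real part.  Consequently
    [power_sol] extends continuously to the segment, although w does not. *)
Lemma Re_pow_cheb (w : R[i]) (s : R) k : -1 <= s <= 1 -> w != 0 -> normc w <= 1 ->
  `|cheb k s - complex.Re (w ^+ k)| <= k%:R * Num.sqrt (2 * normc (jouk w - s%:C%C)).
Proof.
move=> s1 w0 w1.
have close (c : R[i]) d : normc c = 1 -> complex.Re (c ^+ k) = cheb k s ->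
    normc (w - c) <= d -> `|cheb k s - complex.Re (w ^+ k)| <= k%:R * d.
  move=> c1 <- wc; rewrite distrC.
  have -> : complex.Re (w ^+ k) - complex.Re (c ^+ k) = complex.Re (w ^+ k - c ^+ k).
    by case: (w ^+ k) => ? ?; case: (c ^+ k).
  apply: le_trans (Re_le_normc _) _.
  apply: le_trans (normc_pow_sub k w1 _) _; first by rewrite c1.
  by rewrite ler_wpM2l.
set d := Num.sqrt _.
have e : normc (w - upper_circle s) * normc (w - (upper_circle s)^*%C) <= d ^+ 2.
  rewrite sqr_sqrtr ?mulr_ge0 ?normc_ge0// -normcM.
  have -> : (w - upper_circle s) * (w - (upper_circle s)^*%C) = 2 * (jouk w - s%:C%C) * w.
    have -> : (w - upper_circle s) * (w - (upper_circle s)^*%C) =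
        w ^+ 2 - (upper_circle s + (upper_circle s)^*%C) * w +
        upper_circle s * (upper_circle s)^*%C by ring.
    rewrite -sqr_normc (_ : `|upper_circle s| = 1); last first.
      by rewrite -[LHS]/((normc (upper_circle s))%:C%C) normc_upper_circle.
    have -> : upper_circle s + (upper_circle s)^*%C = 2 * s%:C%C.
      by apply/eqP; rewrite eq_complex /=; apply/andP; split; apply/eqP; ring.
    by rewrite /jouk; field.
  rewrite !normcM (normcMn 1 2) normc1.
  by rewrite ler_piMr ?mulr_ge0 ?normc_ge0.
have [h|h] := leP (normc (w - upper_circle s)) d.
  by apply: close h => //; rewrite normc_upper_circle.
apply: (close (upper_circle s)^*%C).
- by rewrite cnormJ normc_upper_circle.
- by rewrite -conjcX cReJ.
rewrite leNgt; apply/negP => h2; move: e; rewrite leNgt expr2 => /negP; apply.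
by apply: ltr_pM; rewrite ?sqrtr_ge0.
Qed.

End boundary.

(** * Components of the complement of a closed set *)

Section component.
Variable R : realType.
Variables (K : set (plane R)) (y : sphere R).
Hypothesis cK : closed K.
Let A := ~` (@fin_pt R @` K).
Let Om := connected_component A y.

Lemma segment_component (z q : plane R) :
  (forall t : R, 0 <= t <= 1 -> ~ K (z + t *: (q - z))) ->
  connected_component A (fin_pt z) (fin_pt q).
Proof.
move=> h; pose f (t : R) : sphere R := fin_pt (z + t *: (q - z)).
apply: (@connected_component_max _ _ (f @` `[0, 1])).
- by exists 0; rewrite /f ?scale0r ?addr0//= in_itv/= lexx ler01.
- by move=> _ [t /= + <-]; rewrite in_itv/= => /h hk [p Kp [pE]]; apply: hk; rewrite -pE.
- apply: connected_continuous_connected; first exact: segment_connected.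
  apply: continuous_subspaceT => t.
  apply: (@continuous_comp _ _ _ (fun t : R => z + t *: (q - z)) (@fin_pt R)); last first.
    exact: one_point_compactification_some_continuous.
  by apply: cvgD; [exact: cvg_cst|apply: cvgZr_tmp; exact: cvg_id].
- by exists 1; rewrite /f ?scale1r 1?addrC ?subrK//= in_itv/= lexx ler01.
Qed.

(** A point off K has a ball around it that avoids K, and this ball lies within a
    single component. *)
Lemma plane_boundary_sub : plane_boundary Om `<=` K.
Proof.
move=> z [cl1 cl2]; apply: contrapT => zK.
have : nbhs z (~` K) by apply: open_nbhs_nbhs; split => //; exact: closed_openC.
move=> /nbhs_ballP[e e0 eK].
pose B : set (plane R) := ball z e.
have conn q : B q -> connected_component A (fin_pt z) (fin_pt q).
  have sc (u v t : R) : 0 <= t <= 1 -> ball u e v -> ball u e (u + t * (v - u)).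
    move=> /andP[t0 t1]; rewrite /ball/= => uv.
    rewrite opprD addrA subrr sub0r normrN normrM ger0_norm// distrC.
    by apply: le_lt_trans uv; rewrite ler_piMl.
  move=> [B1 B2]; apply: segment_component => t t01; apply: eK.
  by split; exact: sc.
have nB : nbhs (fin_pt z) (@fin_pt R @` B).
  by apply: one_point_compactification_some_nbhs; apply: nbhsx_ballx.
have [x [Oq [q Bq qE]]] := cl1 _ nB.
have [x' [Oq' [q' Bq' qE']]] := cl2 _ nB.
apply: Oq'; rewrite -qE'; rewrite -qE in Oq.
apply: connected_component_trans (conn _ Bq').
apply: connected_component_trans Oq _.
by apply: connected_component_sym; exact: conn.
Qed.

Lemma plane_boundary_closed (X : set (sphere R)) : closed (plane_boundary X).
Proof.
apply: closedI.
- apply: (@closed_comp _ _ (@fin_pt R) (closure X)); last exact: closed_closure.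
  by move=> z _; exact: one_point_compactification_some_continuous.
- apply: (@closed_comp _ _ (@fin_pt R) (closure (~` X))); last exact: closed_closure.
  by move=> z _; exact: one_point_compactification_some_continuous.
Qed.

End component.

(** * Moments of harmonic measure *)

Section harmonic_measure_moments.
Variable R : realType.
Variables a b : R.
Hypothesis hab : a < b.

(** The real coordinate, forced into [-1, 1] off the segment so that functions of
    it are bounded on the whole plane. *)
Definition clamped_coord (z : plane R) : R :=
  Num.max (-1) (Num.min 1 ((z.1 - midpt a b) / halflen a b)).

Lemma clamped_coord_bound z : -1 <= clamped_coord z <= 1.
Proof. by rewrite /clamped_coord le_max lexx/= ge_max ge_min lexx/= andbT; lra. Qed.

Lemma clamped_coord_segment z : real_segment a b z -> affine_coord a b z = (clamped_coord z)%:C%C.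
Proof.
case=> x /=; rewrite in_itv/= => xab <-.
rewrite affine_coord_real /clamped_coord/=; move: xab.
rewrite (itv_affine_coord hab) => /andP[h1 h2].
by rewrite min_r// max_r.
Qed.

Lemma clamped_coord_continuous : continuous clamped_coord.
Proof.
move=> z; apply: (@continuous_max R (plane R)); first exact: cvg_cst.
apply: (@continuous_min R (plane R)); first exact: cvg_cst.
apply: cvgM; last exact: cvg_cst.
by apply: cvgB; [exact: cvg_fst|exact: cvg_cst].
Qed.

Lemma clamped_coord_measurable : measurable_fun [set: plane R] clamped_coord.
Proof.
apply: measurable_maxr => //; apply: measurable_minr => //.
by apply: measurable_funM => //; apply: measurable_funB => //; exact: measurable_fst.
Qed.

Lemma capacity_set0 : capacity (set0 : set (plane R)) = 0%E.
Proof.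
rewrite /capacity.
have cc0 : compact_capacity (set0 : set (plane R)) = 0%E.
  rewrite /compact_capacity.
  set S := [set _ | _ in _].
  have -> : S = set0.
    apply/seteqP; split => // x [mu /= + _].
    rewrite /supported_in setC0 => mu0.
    by have := probability_setT mu; rewrite mu0 => /esym/eqP; rewrite onee_eq0.
  by rewrite ereal_inf0 /=.
have -> : [set compact_capacity K | K in [set K | compact K /\ K `<=` (set0 : set (plane R))]] =
    [set 0%E].
  apply/seteqP; split=> [_ [K [_ K0] <-]|_ ->].
    by rewrite (_ : K = set0) ?cc0//; apply/seteqP; split.
  by exists set0 => //; split => //; exact: compact0.
by rewrite ereal_sup1.
Qed.

(** Such a set is the product of a closed subset of the line and {0}. *)
Lemma real_set_measurable (B : set (plane R)) :
  closed B -> B `<=` real_segment a b -> measurable B.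
Proof.
move=> cB Bs.
have -> : B = (@real_pt R @^-1` B) `*` [set 0].
  apply/seteqP; split=> [z Bz|[x _] [/= Bx ->]//].
  by have [x _ xz] := Bs z Bz; move: Bz; rewrite -xz.
apply: measurableX; last exact: measurable_set1.
apply: closed_measurable; apply: closed_comp cB => x _.
have c0 : (fun=> 0 : R) @ x --> (0 : R) by exact: cvg_cst.
have ci : id @ x --> x by exact: cvg_id.
exact: (cvg_pair ci c0).
Qed.

Lemma real_segment_measurable : measurable (real_segment a b).
Proof. by apply: real_set_measurable => //; exact: real_segment_closed. Qed.

Variable y : R.
Hypothesis hy : ~ (a <= y <= b).
Variable omega : probability (plane R) R.
Hypothesis homega : is_harmonic_measure_compl (fin_pt (real_pt y)) (real_segment a b) omega.

Let Om := connected_component (~` (@fin_pt R @` real_segment a b)) (fin_pt (real_pt y)).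

Let Om_sub : Om `<=` ~` (@fin_pt R @` real_segment a b).
Proof. exact: connected_component_sub. Qed.

Let bd_sub : plane_boundary Om `<=` real_segment a b.
Proof. by apply: plane_boundary_sub; exact: real_segment_closed. Qed.

Lemma power_sol_boundary k z : real_segment a b z ->
  power_sol hab k x @[x --> within Om (nbhs (fin_pt z))] --> cheb k (clamped_coord z).
Proof.
move=> zK; apply/cvgrPdist_le => eps eps0.
pose g q : R := k%:R * Num.sqrt (2 * normc (affine_coord a b q - affine_coord a b z)).
have g0 : g q @[q --> z] --> (0 : R).
  have -> : (0 : R) = k%:R * Num.sqrt (2 * normc (affine_coord a b z - affine_coord a b z)).
    by rewrite subrr normc0 mulr0 sqrtr0 mulr0.
  apply: cvgM; first exact: cvg_cst.
  apply: (continuous_cvg _ (@sqrt_continuous _ _)).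
  apply: cvgM; first exact: cvg_cst.
  apply: ccvg_normc; apply: ccvgD; last exact: ccvg_cst.
  apply: ccvgM; last exact: ccvg_cst.
  by apply: ccvgD; [exact: toC_cvg|exact: ccvg_cst].
have near_q : \forall q \near z, Om (fin_pt q) ->
    `|cheb k (clamped_coord z) - power_sol hab k (fin_pt q)| <= eps.
  move/cvgrPdist_le : g0 => /(_ _ eps0) g0; near=> q => Oq.
  have qK : ~ real_segment a b q by move=> qK; apply: (Om_sub Oq); exists q.
  have [w0 wE] := disc_coord_jouk hab qK.
  have := Re_pow_cheb k (clamped_coord_bound z) w0 (ltW (disc_coord_lt1 hab q)).
  rewrite -wE -clamped_coord_segment// => h; apply: le_trans h _.
  have : `|0 - g q| <= eps by near: q.
  by rewrite sub0r normrN; apply: le_trans; exact: ler_norm.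
rewrite /within/= /nbhs/= /one_point_nbhs/=.
exact: near_q.
Unshelve. all: by end_near. Qed.

(** Its conjugate is a preimage of the same point, so it is real by uniqueness. *)
Lemma disc_coord_real_pt : exists eta : R, `|eta| < 1 /\ disc_coord hab (real_pt y) = eta%:C%C.
Proof.
have yK : ~ real_segment a b (real_pt y).
  by move=> [x /=]; rewrite in_itv/= => xab [xy]; apply: hy; rewrite -xy.
have [w0 wE] := disc_coord_jouk hab yK; have w1 := disc_coord_lt1 hab (real_pt y).
set w := disc_coord _ _ in w0 wE w1 *.
have cw : jouk w = jouk (w^*)%C.
  have -> : jouk (w^*)%C = (jouk w)^*%C.
    rewrite /jouk rmorphM rmorphD !fmorphV; congr (_ * _^-1); exact: esym (conjc_nat R 2).
  by rewrite -wE affine_coord_real conjc_real.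
have e : w = (w^*)%C.
  apply: jouk_inj => //; first by rewrite conjc_eq0.
  by rewrite cnormJ ltW.
have im0 : w = (complex.Re w)%:C%C.
  by case: (w) e => u v [/eqP]; rewrite -addr_eq0 -mulr2n mulrn_eq0/= => /eqP ->.
exists (complex.Re w); split => //.
by rewrite -normc_real -im0.
Qed.

(** The defining property of harmonic measure, applied to T_k and [power_sol]. *)
Lemma harmonic_moments : exists2 eta : R, `|eta| < 1 &
  forall k, (\int[omega]_z cheb k (clamped_coord z))%R = eta ^+ k.
Proof.
have [eta [eta1 etaE]] := disc_coord_real_pt; exists eta => // k.
have [supp hm] := homega.
have fc : continuous (fun z : plane R => cheb k (clamped_coord z)).
  by move=> z; apply: (continuous_comp (@clamped_coord_continuous z) (@cheb_continuous R k _)).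
have mf : measurable_fun setT (fun z => cheb k (clamped_coord z)).
  apply: measurableT_comp clamped_coord_measurable.
  exact: continuous_measurable_fun (@cheb_continuous _ _).
have sol : solves_dirichlet Om (fun z => cheb k (clamped_coord z)) (power_sol hab k).
  split.
  - exact: power_sol_harmonic.
  - by exists 1 => x _; exact: power_sol_bounded.
  - rewrite (_ : [set z | _] = set0) ?capacity_set0//.
    apply/seteqP; split => // z [/bd_sub zK]; apply.
    exact: power_sol_boundary.
have := hm _ (continuous_subspaceT fc) _ sol.
have mB : measurable (plane_boundary Om).
  by apply: real_set_measurable bd_sub; exact: plane_boundary_closed.
have int : omega.-integrable setT (EFin \o (fun z => cheb k (clamped_coord z))).
  apply: (bounded_integrable (probability_setT omega) mf) => z.
  exact: cheb_le1 (clamped_coord_bound z).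
have -> : (\int[omega]_(z in plane_boundary Om) (cheb k (clamped_coord z))%:E =
    \int[omega]_z (cheb k (clamped_coord z))%:E)%E.
  rewrite [RHS](negligible_integral (N := ~` plane_boundary Om))//; last exact: measurableC.
  by rewrite setTD setCK.
rewrite /Rintegral => <- /=.
by rewrite etaE -rmorphXn.
Qed.

End harmonic_measure_moments.

(** * Integrals against a measure carried by a set *)

Section supported_integral.
Context d (T : measurableType d) (R : realType).
Variable mu : {measure set T -> \bar R}.
Variable K : set T.
Hypothesis mK : measurable K.
Hypothesis muK : mu (~` K) = 0%E.
Import HBNNSimple.

(** The integral of any nonnegative function is a supremum over the simple
    functions below it, and multiplying these by the indicator of K does not change
    their integrals.  Potentials, as functions of a point, can thus be compared
    directly, through their values on the support. *)
Lemma ge0_le_integral_supp (f g : T -> \bar R) :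
  (forall x, 0 <= f x)%E -> (forall x, 0 <= g x)%E ->
  (forall x, K x -> f x <= g x)%E -> (\int[mu]_x f x <= \int[mu]_x g x)%E.
Proof.
move=> f0 g0 fg; rewrite !ge0_integralTE//.
apply: ub_ereal_sup => _ [h hf <-].
have -> : sintegral mu h = sintegral mu (proj_nnsfun h mK).
  rewrite -!integralT_nnsfun; apply: ge0_ae_eq_integral => //.
  - exact/measurable_EFinP.
  - exact/measurable_EFinP.
  - by move=> x _; rewrite lee_fin.
  - by move=> x _; rewrite lee_fin.
  exists (~` K); split => //; first exact: measurableC.
  move=> x /= hx Kx; apply: hx => _; rewrite mindicE mem_set//.
  by rewrite mulr1.
apply: ereal_sup_ubound; exists (proj_nnsfun h mK) => // x /=.
rewrite mindicE; case: (boolP (x \in K)) => [/set_mem Kx|_].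
  by rewrite mulr1; apply: le_trans (hf x) (fg x Kx).
by rewrite mulr0.
Qed.

Lemma le_integral_supp (f g : T -> \bar R) :
  (forall x, K x -> f x <= g x)%E -> (\int[mu]_x f x <= \int[mu]_x g x)%E.
Proof.
move=> fg; rewrite integralE [leRHS]integralE; apply: leeB.
  apply: ge0_le_integral_supp => // x Kx.
  by rewrite !funeposE ge_max le_max fg//= le_max lexx orbT.
apply: ge0_le_integral_supp => // x Kx.
by rewrite !funenegE ge_max !le_max leeN2 fg//= lexx orbT.
Qed.

Lemma eq_integral_supp (f g : T -> \bar R) :
  (forall x, K x -> f x = g x)%E -> (\int[mu]_x f x = \int[mu]_x g x)%E.
Proof.
by move=> fg; apply/eqP; rewrite eq_le; apply/andP; split;
  apply: le_integral_supp => x Kx; rewrite fg.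
Qed.

End supported_integral.

(** * Logarithmic potentials on the segment *)

Section log_potential.
Variable R : realType.
Variables a b : R.
Hypothesis hab : a < b.

Lemma log_abs_kern p (w : R[i]) z : w != 0 -> affine_coord a b p = jouk w -> real_segment a b z ->
  log_abs (z - p)%R = (lne (kern w (clamped_coord a b z))%:E +
    (ln (halflen a b / (2 * normc w)))%:E)%E.
Proof.
move=> w0 pE zK; have h0 := halflen_gt0 hab.
have n0 : 0 < normc w by rewrite normc_gt0.
have hC0 : (halflen a b)%:C%C != 0 :> R[i] by rewrite fmorph_eq0 gt_eqF.
have e : cabs (z - p) = kern w (clamped_coord a b z) * (halflen a b / (2 * normc w)).
  rewrite /cabs toCB.
  have -> : toC z - toC p = (halflen a b)%:C%C * (affine_coord a b z - affine_coord a b p).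
    by rewrite /affine_coord -mulrBl mulrC mulfVK//; ring.
  rewrite normcM normc_real gtr0_norm// pE clamped_coord_segment// normc_jouk_sub//.
  by field; rewrite gt_eqF.
rewrite /log_abs e.
have c0 : 0 < halflen a b / (2 * normc w) by rewrite divr_gt0// mulr_gt0.
have := kern_ge0 w (clamped_coord a b z); rewrite le_eqVlt => /predU1P[<-|k0].
  by rewrite mul0r /lne lexx.
by rewrite (lne_EFin k0) (lne_EFin (mulr_gt0 k0 c0)) [X in (X)%:E = _]lnM ?posrE.
Qed.

Variable mu : {measure set (plane R) -> \bar R}.
Hypothesis mu1 : mu setT = 1%E.
Hypothesis muK : mu (~` real_segment a b) = 0%E.
Variables (N : nat) (t eta : 'I_N -> R).
Hypothesis t0 : forall j, 0 <= t j.
Hypothesis tsum : \sum_j t j = 1.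
Hypothesis eta1 : forall j, `|eta j| < 1.
Hypothesis moments : forall k,
  (\int[mu]_x cheb k.+1 (clamped_coord a b x))%R = \sum_j t j * eta j ^+ k.+1.

Lemma integral_log_abs p (w : R[i]) : w != 0 -> normc w <= 1 -> affine_coord a b p = jouk w ->
  (\int[mu]_z log_abs (z - p)%R =
   (mixpot t eta w + ln (halflen a b / (2 * normc w)))%:E)%E.
Proof.
move=> w0 w1 pE.
have := eq_integral_supp (real_segment_measurable a b) muK
  (f := fun z => log_abs (z - p)%R) (fun z zK => log_abs_kern w0 pE zK).
move=> ->.
have ms := clamped_coord_measurable a b.
have mb := clamped_coord_bound a b.
have [ki ke] := integral_lne_kern mu1 ms mb t0 tsum eta1 moments w1.
set c := ln (halflen a b / _).
rewrite integralD//; last exact: (bounded_integrable mu1 (f := fun=> c) (M := `|c|)).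
by rewrite ke integral_cst// mu1 mule1.
Qed.

Lemma log_absC (z p : plane R) : log_abs (z - p) = log_abs (p - z).
Proof. by rewrite /log_abs /cabs -opprB /toC /= !sqrrN. Qed.

Lemma integral_Nlog_abs p (w : R[i]) : w != 0 -> normc w <= 1 -> affine_coord a b p = jouk w ->
  (\int[mu]_z (- log_abs (p - z)%R) =
   (- (mixpot t eta w + ln (halflen a b / (2 * normc w))))%:E)%E.
Proof.
move=> w0 w1 pE.
have := eq_integral_supp (real_segment_measurable a b) muK
  (f := fun z => (- log_abs (p - z)%R)%E) (fun z zK =>
  f_equal oppe (etrans (log_absC p z) (log_abs_kern w0 pE zK))).
move=> ->.
have ms := clamped_coord_measurable a b.
have mb := clamped_coord_bound a b.
have [ki ke] := integral_lne_kern mu1 ms mb t0 tsum eta1 moments w1.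
set c := ln (halflen a b / _).
have ci : mu.-integrable setT (EFin \o cst c).
  exact: (bounded_integrable mu1 (f := fun=> c) (M := `|c|)).
rewrite integralN; last exact/integrable_add_def/integrableD.
by rewrite integralD// ke integral_cst// mu1 mule1.
Qed.

End log_potential.

(** * The arcsine law *)

Section arcsine.
Variable R : realType.
Variables a b : R.

Lemma cheb_cos k (x : R) : 0 <= x <= pi -> cheb k (cos x) = cos (k%:R * x).
Proof.
move=> x0pi; rewrite /cheb /upper_circle -sin2cos2 sqrtr_sqr ger0_norm ?sin_ge0_pi//.
suff -> : (Complex (cos x) (sin x)) ^+ k = Complex (cos (k%:R * x)) (sin (k%:R * x)) by [].
elim: k => [|k ih]; first by rewrite expr0 mul0r cos0 sin0.
rewrite exprSr ih -natr1 mulrDl mul1r cosD sinD.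
by apply/eqP; rewrite eq_complex/=; apply/andP; split; apply/eqP; ring.
Qed.

Lemma sin_kpi k : sin (k%:R * pi) = 0 :> R.
Proof.
elim: k => [|k ih]; first by rewrite mul0r sin0.
by rewrite -natr1 mulrDl mul1r sinDpi ih oppr0.
Qed.

(** The point of the segment with angular coordinate x; the arcsine law is the
    image of the uniform law on [0, pi]. *)
Definition arc_pt (x : measurableTypeR R) : plane R := real_pt (midpt a b + halflen a b * cos x).

Lemma arc_pt_measurable : measurable_fun [set: measurableTypeR R] arc_pt.
Proof.
apply: measurable_fun_pair => //.
apply: measurable_funD => //; apply: measurable_funM => //.
exact: continuous_measurable_fun (@continuous_cos R).
Qed.

HB.instance Definition _ := isMeasurableFun.Build _ _ _ _ arc_pt arc_pt_measurable.

Definition arcsine : probability (plane R) R :=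
  distribution (uniform_prob (@pi_gt0 R)) arc_pt.

Hypothesis hab : a < b.

Lemma clamped_coord_arc x : clamped_coord a b (arc_pt x) = cos x.
Proof.
rewrite /clamped_coord /arc_pt /= addrAC subrr add0r mulrAC mulfV ?mul1r ?gt_eqF ?halflen_gt0//.
by rewrite min_r ?cos_le1// max_r ?cos_geN1.
Qed.

Lemma arcsine_supported : supported_in arcsine (real_segment a b).
Proof.
rewrite /supported_in /arcsine /distribution /= /pushforward.
rewrite (_ : arc_pt @^-1` _ = set0) ?measure0//.
apply/seteqP; split => // x; apply; apply/real_segmentP => //.
exists (cos x); first by rewrite cos_le1 cos_geN1.
by rewrite affine_coord_real addrAC subrr add0r mulrAC mulfV ?mul1r// gt_eqF// halflen_gt0.
Qed.

(** T_k(cos x) = cos (k x) has mean zero over [0, pi].  The constant 1 is added to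
    make the integrand nonnegative. *)
Lemma arcsine_moments k : (\int[arcsine]_z cheb k.+1 (clamped_coord a b z))%R = 0.
Proof.
have mc : measurable_fun [set: plane R] (fun z => cheb k.+1 (clamped_coord a b z)).
  apply: measurableT_comp (clamped_coord_measurable a b).
  exact: continuous_measurable_fun (@cheb_continuous _ _).
have ci : arcsine.-integrable setT (EFin \o (fun z => cheb k.+1 (clamped_coord a b z))).
  apply: (bounded_integrable (probability_setT arcsine) mc (M := 1)) => z.
  exact: cheb_le1 (clamped_coord_bound a b z).
have key : (\int[arcsine]_z (1 + cheb k.+1 (clamped_coord a b z))%:E = 1)%E.
  have c0 z : 0 <= 1 + cheb k.+1 (clamped_coord a b z).
    by have := cheb_le1 k.+1 (clamped_coord_bound a b z); rewrite ler_norml => /andP[]; lra.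
  rewrite ge0_integral_distribution//; last first.
    by apply/measurable_EFinP; exact: measurable_funD.
  have mcos : measurable_fun [set: R] (fun x : R => 1 + cheb k.+1 (cos x)).
    apply: measurable_funD => //; apply: measurableT_comp.
      exact: continuous_measurable_fun (@cheb_continuous _ _).
    exact: continuous_measurable_fun (@continuous_cos R).
  have -> : ((fun y => (1 + cheb k.+1 (clamped_coord a b y))%:E) \o arc_pt =
      (fun x => (1 + cheb k.+1 (cos x))%:E)).
    by apply/funext => x /=; rewrite clamped_coord_arc.
  rewrite integral_uniform; [|exact/measurable_EFinP|]; last first.
    by move=> x; rewrite lee_fin; have := c0 (arc_pt x); rewrite clamped_coord_arc.
  pose f (x : R) := 1 + cos (k.+1%:R * x).
  pose F (x : R) := x + k.+1%:R^-1 * sin (k.+1%:R * x).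
  have k0 : k.+1%:R != 0 :> R by rewrite pnatr_eq0.
  have dF (x : R) : is_derive x 1 F (f x).
    have dl : is_derive x 1 (fun x : R => k.+1%:R * x) k.+1%:R.
      by apply: is_derive_eq; rewrite /GRing.scale/= mulr1.
    have ds := is_deriveZ (k.+1%:R^-1)
      (@is_derive1_comp _ _ _ _ _ _ (is_derive_sin (k.+1%:R * x)) dl).
    have d := is_deriveD (is_derive_id x 1) ds.
    by apply: (is_derive_eq d); rewrite /f /GRing.scale/= [_ * k.+1%:R]mulrC mulKf.
  have cF : continuous F.
    by move=> x; apply: differentiable_continuous; apply/derivable1_diffP; case: (dF x).
  under [X in (_ * X)%E]eq_integral => x.
    rewrite inE/= in_itv/= => xp; rewrite cheb_cos// -/(f x); over.
  rewrite (@continuous_FTC2 _ f F)//.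
  - rewrite /F sin_kpi !mulr0 sin0 mulr0 !addr0 !sube0 subr0 -EFinM mulVf//.
    by rewrite gt_eqF// pi_gt0.
  - exact: pi_gt0.
  - apply: continuous_subspaceT => x; apply: cvgD; first exact: cvg_cst.
    apply: (@continuous_comp _ _ _ (fun x : R => k.+1%:R * x) (@cos R)); last exact: continuous_cos.
    by apply: cvgM; [exact: cvg_cst|exact: cvg_id].
  - split.
    + by move=> x _; case: (dF x).
    + exact: cvg_at_right_filter (cF _).
    + exact: cvg_at_left_filter (cF _).
  - by move=> x _; rewrite derive1E; apply: derive_val.
have : (\int[arcsine]_z (1 + cheb k.+1 (clamped_coord a b z)))%R = 1.
  by rewrite /Rintegral key.
rewrite RintegralD//.
  by rewrite Rintegral_cst1//; [lra|exact: probability_setT].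
exact: (bounded_integrable (probability_setT arcsine) (f := cst 1) (M := `|1|)).
Qed.

(** All moments vanish, so the potential is constant on the segment. *)
Lemma arcsine_energy : (log_energy arcsine <= (ln 2 - ln (halflen a b))%:E)%E.
Proof.
rewrite /log_energy.
have h0 := halflen_gt0 hab.
have inner z : real_segment a b z ->
    (\int[arcsine]_w (- log_abs (z - w)%R) <= (ln 2 - ln (halflen a b))%:E)%E.
  move=> zK.
  (* Zero moments are those of a mixture with the single parameter eta = 0. *)
  have [w [w0 w1 e]] := jouk_surj (affine_coord a b z).
  have mom k : (\int[arcsine]_x cheb k.+1 (clamped_coord a b x))%R = \sum_(j < 1) 1 * 0 ^+ k.+1.
    by rewrite arcsine_moments big1// => j _; rewrite expr0n mulr0.
  have s1 : \sum_(j < 1) (1 : R) = 1 by rewrite big_ord1.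
  have z1 (j : 'I_1) : `|0 : R| < 1 by rewrite normr0.
  have I := integral_Nlog_abs hab (probability_setT arcsine) arcsine_supported
    (fun _ => ler01) s1 z1 mom w0 w1 e.
  rewrite I lee_fin /mixpot big_ord1 mul0r subr0 normc1 ln1 mulr0 mulr0 add0r.
  have n0 : 0 < normc w by rewrite normc_gt0.
  have -> : ln (halflen a b / (2 * normc w)) = ln (halflen a b) - (ln 2 + ln (normc w)).
    have n2 : 0 < 2 * normc w by rewrite mulr_gt0.
    by rewrite -lnM ?posrE// -ln_div ?posrE.
  move: (ln (normc w)) (ln 2) (ln (halflen a b)) (ln_le0 w1) => x u v; clear; lra.
apply: le_trans (le_integral_supp (real_segment_measurable a b) arcsine_supported inner) _.
by rewrite integral_cst// [X in (_ * X)%E](probability_setT arcsine) mule1.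
Qed.

End arcsine.

(** * Moments of the equilibrium measure *)

Section equilibrium.
Variable R : realType.
Variables a b : R.
Hypothesis hab : a < b.
Variable nu : probability (plane R) R.
Hypothesis hnu : is_equilibrium_measure (real_segment a b) nu.

Let T k (z : plane R) := cheb k.+1 (clamped_coord a b z).
Let c k := (\int[nu]_z T k z)%R.
Let nu1 : nu setT = 1%E. Proof. exact: probability_setT. Qed.
Let nuK : nu (~` real_segment a b) = 0%E. Proof. by case: hnu. Qed.

Let mT k : measurable_fun setT (T k).
Proof.
apply: measurableT_comp (clamped_coord_measurable a b).
exact: continuous_measurable_fun (@cheb_continuous _ _).
Qed.

Let T1 k z : `|T k z| <= 1.
Proof. exact: cheb_le1 (clamped_coord_bound a b z). Qed.

Let lin_integral (e : nat -> R) n D :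
  (\int[nu]_z (\sum_(k < n) e k * T k z + D)%:E = (\sum_(k < n) e k * c k + D)%:E)%E.
Proof.
have ms : measurable_fun setT (fun z => \sum_(k < n) e k * T k z).
  by apply: measurable_sum => k; exact: measurable_funM.
have is_ : nu.-integrable setT (EFin \o (fun z => \sum_(k < n) e k * T k z)).
  apply: (bounded_integrable nu1 ms (M := \sum_(k < n) `|e k|)) => z.
  apply: le_trans (ler_norm_sum _ _ _) _; apply: ler_sum => k _.
  by rewrite normrM ler_piMr.
have iD : nu.-integrable setT (EFin \o cst D).
  exact: (bounded_integrable nu1 (f := cst D) (M := `|D|)).
rewrite integralD_EFin//= [X in (_ + X)%E]integral_cst// [X in (_ * X)%E]nu1 mule1.
rewrite EFinD; congr (_ + _)%E.
rewrite -(Rintegral_lin nu1 e n mT T1) /Rintegral fineK//.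
exact: integrable_fin_num.
Qed.

(** On the segment w = e^{i theta} has modulus 1; scaling it by r < 1 costs ln r
    by [kern_radial], and the series then converges. *)
Let lower (r : R) n z u : 0 < r < 1 -> real_segment a b z -> real_segment a b u ->
  ((\sum_(k < n) (2 * r ^+ k.+1 / k.+1%:R * T k z) * T k u +
    (ln r - ln (halflen a b / 2) - 2 * r ^+ n.+1 / (1 - r)))%:E <= - log_abs (z - u)%R)%E.
Proof.
move=> /andP[r0 r1] zK uK.
have zb := clamped_coord_bound a b z; have ub := clamped_coord_bound a b u.
have w1 := normc_upper_circle zb.
have w0 : upper_circle (clamped_coord a b z) != 0 by rewrite -normc_gt0 w1.
have e : affine_coord a b z = jouk (upper_circle (clamped_coord a b z)).
  by rewrite jouk_upper_circle// clamped_coord_segment.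
rewrite log_absC (log_abs_kern hab w0 e uK) w1 mulr1.
set w := upper_circle _ in w1 w0 e *; set s := clamped_coord a b u.
have rw1 : normc (r%:C%C * w) < 1 by rewrite normcM w1 mulr1 normc_real gtr0_norm.
have rad : r * kern w s <= kern (r%:C%C * w) s.
  by apply: kern_radial; rewrite ?w1// !ltW.
have := ln_kern_series n rw1 ub.
have -> : \sum_(k < n) 2 * complex.Re ((r%:C%C * w) ^+ k.+1) *
      cheb k.+1 (clamped_coord a b u) / k.+1%:R =
    \sum_(k < n) (2 * r ^+ k.+1 / k.+1%:R * T k z) * T k u.
  apply: eq_bigr => k _; rewrite exprMn -rmorphXn/= cReZ.
  by rewrite -/(cheb k.+1 (clamped_coord a b z)) -/(T k z) -/(T k u); ring.
rewrite normcM w1 mulr1 normc_real [`|r|]gtr0_norm// ler_norml => /andP[_ hs].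
have := kern_ge0 w s; rewrite le_eqVlt => /predU1P[<-|k0].
  by rewrite /lne lexx /= leey.
rewrite lne_EFin// -EFinD -EFinN lee_fin.
have : ln r + ln (kern w s) <= ln (kern (r%:C%C * w) s).
  rewrite -lnM ?posrE// ler_ln ?posrE//; first by rewrite mulr_gt0.
  exact: kern_gt0.
move: hs; rewrite -/s.
move: (\sum_(k < n) _) (ln (halflen a b / 2)) (ln r) (ln _) (ln _) (2 * _ / _) => x1 x2 x3 x4 x5 x6.
lra.
Qed.

(** Integrating [lower] in both variables turns the series into a sum of squares
    of moments.  The constant term agrees with the energy of the arcsine law. *)
Let energy_bound (r : R) n : 0 < r < 1 ->
  \sum_(k < n) (2 * r ^+ k.+1 / k.+1%:R) * c k ^+ 2 <=
  2 * r ^+ n.+1 / (1 - r) - ln r.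
Proof.
move=> r01; have [_ /(_ _ (arcsine_supported hab)) en] := hnu.
have := le_trans en (arcsine_energy hab).
set D := ln r - ln (halflen a b / 2) - 2 * r ^+ n.+1 / (1 - r).
have inner z : real_segment a b z ->
    ((\sum_(k < n) (2 * r ^+ k.+1 / k.+1%:R * c k) * T k z + D)%:E <=
    \int[nu]_w (- log_abs (z - w)%R))%E.
  move=> zK.
  have := le_integral_supp (real_segment_measurable a b) nuK (fun u uK => lower n r01 zK uK).
  rewrite (lin_integral (fun k => 2 * r ^+ k.+1 / k.+1%:R * T k z)).
  apply: le_trans; rewrite lee_fin lerD2r.
  by rewrite le_eqVlt; apply/orP; left; apply/eqP; apply: eq_bigr => k _; ring.
have := le_integral_supp (real_segment_measurable a b) nuK inner.
rewrite (lin_integral (fun k => 2 * r ^+ k.+1 / k.+1%:R * c k)) -/(log_energy nu) => h1 h2.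
have := le_trans h1 h2; rewrite lee_fin /D.
have h0 := halflen_gt0 hab.
have -> : ln (halflen a b / 2) = ln (halflen a b) - ln 2 by rewrite -ln_div ?posrE.
have -> : \sum_(k < n) 2 * r ^+ k.+1 / k.+1%:R * c k * c k =
   \sum_(k < n) (2 * r ^+ k.+1 / k.+1%:R) * c k ^+ 2.
  by apply: eq_bigr => k _; rewrite -mulrA expr2.
move: (\sum_(k < n) _) (ln (halflen a b)) (ln 2) (ln r) (2 * _ / _) => x1 x2 x3 x4 x5.
lra.
Qed.

Let term_bound (r : R) k : 0 < r < 1 ->
  (2 * r ^+ k.+1 / k.+1%:R) * c k ^+ 2 <= - ln r.
Proof.
move=> r01; have /andP[r0 r1] := r01.
have cv : (2 * r / (1 - r)) * r ^+ n - ln r @[n --> \oo] --> (- ln r).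
  rewrite -[X in _ --> X]add0r; apply: cvgB; last exact: cvg_cst.
  by apply: cvg_geometric; rewrite gtr0_norm.
apply: (cvgr_to_ge cv); exists k.+1 => // n /= kn.
have -> : 2 * r / (1 - r) * r ^+ n = 2 * r ^+ n.+1 / (1 - r) by rewrite exprS; ring.
apply: le_trans (energy_bound n r01).
rewrite (bigD1 (Ordinal kn))//= lerDl; apply: sumr_ge0 => j _.
by rewrite mulr_ge0 ?sqr_ge0// divr_ge0// mulr_ge0// exprn_ge0// ltW.
Qed.

(** Let n tend to infinity, then r to 1, in [energy_bound]. *)
Lemma equilibrium_moments k : (\int[nu]_z cheb k.+1 (clamped_coord a b z))%R = 0.
Proof.
apply/eqP; rewrite -sqrf_eq0 -/(c k) eq_le sqr_ge0 andbT.
have cv : - ln r - (2 * r ^+ k.+1 / k.+1%:R) * c k ^+ 2 @[r --> (1 : R)^'-] -->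
    - ln 1 - (2 * 1 ^+ k.+1 / k.+1%:R) * c k ^+ 2.
  apply: cvg_at_left_filter; apply: cvgB.
    by apply: cvgN; apply: continuous_ln.
  apply: cvgM; last exact: cvg_cst.
  apply: cvgM; last exact: cvg_cst.
  apply: cvgM; first exact: cvg_cst.
  exact: exprn_continuous.
have : 0 <= - ln 1 - (2 * 1 ^+ k.+1 / k.+1%:R) * c k ^+ 2.
  apply: (cvgr_to_ge cv); near=> r; rewrite subr_ge0; apply: term_bound.
  by apply/andP; split; near: r; [exact: nbhs_left_gt|exact: nbhs_left_lt].
rewrite ln1 oppr0 sub0r oppr_ge0 expr1n mulr1 pmulr_rle0//.
Unshelve. all: by end_near. Qed.

End equilibrium.

(** * Mixtures and integer polynomials *)

Section mixture_integral.
Context d (T : measurableType d) (R : realType) (n : nat).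
Variables (t : 'I_n.+1 -> {nonneg R}) (nu : {measure set T -> \bar R})
  (omega : 'I_n -> {measure set T -> \bar R}).
Local Open Scope ereal_scope.

(** A mixture is a finite sum of scaled measures. *)
Lemma ge0_integral_mixture (f : T -> \bar R) : measurable_fun setT f ->
  (forall x, 0 <= f x) ->
  \int[mixture t nu omega]_x f x =
  (t ord0)%:num%:E * \int[nu]_x f x +
  \sum_(i < n) (t (lift ord0 i))%:num%:E * \int[omega i]_x f x.
Proof.
move=> mf f0.
pose m (k : nat) : {measure set T -> \bar R} :=
  mscale (t (inord k)) (oapp omega nu (unlift ord0 (inord k))).
have i0 : inord 0 = ord0 :> 'I_n.+1 by apply/val_inj; rewrite /= inordK.
have iS (i : 'I_n) : inord (bump 0 i) = lift ord0 i :> 'I_n.+1.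
  by apply/val_inj; rewrite /= inordK// ltnS; exact: ltn_ord.
rewrite [LHS](eq_measure_integral (msum m n.+1)); last first.
  move=> A _ _; rewrite /= /mixture /msum big_ord_recl/= /mscale i0 unlift_none/=.
  by congr (_ + _); apply: eq_bigr => i _; rewrite iS liftK.
rewrite ge0_integral_measure_sum// big_ord_recl/=.
rewrite ge0_integral_mscale//= i0 unlift_none/=; congr (_ + _).
by apply: eq_bigr => i _; rewrite ge0_integral_mscale//= iS liftK.
Qed.

End mixture_integral.

Section polynomial.
Variable R : realType.

Lemma lne_mul (x y : R) : 0 <= x -> 0 <= y ->
  lne (x * y)%:E = (lne x%:E + lne y%:E)%E.
Proof.
rewrite le_eqVlt => /predU1P[<- _|x0].
  by rewrite mul0r /lne lexx; case: ifP.
rewrite le_eqVlt => /predU1P[<-|y0].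
  by rewrite mulr0 /lne lexx addeNy.
by rewrite !lne_EFin ?mulr_gt0// lnM ?posrE.
Qed.

Lemma normc_int (m : int) : normc (m%:~R : R[i]) = `|m|%:~R.
Proof. by rewrite -(rmorph_int (real_complex R)) normc_real intr_norm. Qed.

End polynomial.

Unset Implicit Arguments.

Theorem corollary5p4 (R : realType) (a b : R) (hab : a < b)
    (n : nat) (y : 'I_n -> R) (hy : forall i, ~ (a <= y i <= b))
    (t : 'I_n.+1 -> {nonneg R}) (ht1 : forall i, (t i)%:num <= 1)
    (htsum : \sum_i (t i)%:num = 1)
    (nu : probability (plane R) R)
    (hnu : is_equilibrium_measure (real_segment a b) nu)
    (omega : 'I_n -> probability (plane R) R)
    (homega : forall i, is_harmonic_measure_compl (fin_pt (real_pt (y i)))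
                          (real_segment a b) (omega i)) :
  let mu_t := mixture t nu omega in
  (0 <= \int[mu_t]_z log_abs (z - real_pt a)%R)%E ->
  (0 <= \int[mu_t]_z log_abs (z - real_pt b)%R)%E ->
  forall Q : {poly int}, Q != 0 ->
    (0 <= \int[mu_t]_z log_abs_poly Q z)%E.
Proof.
move=> mu_t.
have /choice[e he] : forall i, exists e : R, `|e| < 1 /\
    forall k, (\int[omega i]_z cheb k (clamped_coord a b z))%R = e ^+ k.
  move=> i; have [e e1 eE] := harmonic_moments hab (hy i) (homega i).
  by exists e.
(* The index 0 stands for the equilibrium measure, with parameter 0. *)
pose eta (j : 'I_n.+1) : R :=
  if unlift ord0 j is Some i then e i else 0.
pose tt (j : 'I_n.+1) : R := (t j)%:num.
have tt0 j : 0 <= tt j by rewrite /tt.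
have eta1 j : `|eta j| < 1.
  rewrite /eta; case: unliftP => [i _|_]; last by rewrite normr0.
  by have [] := he i.
have nuK : nu (~` real_segment a b) = 0%E by case: hnu.
have omK i : omega i (~` real_segment a b) = 0%E.
  have [supp _] := homega i; move: supp; set B := plane_boundary _ => supp.
  have Bs : B `<=` real_segment a b.
    by apply: plane_boundary_sub; exact: real_segment_closed.
  have mB : measurable B by apply: real_set_measurable Bs; exact: plane_boundary_closed.
  apply: (subset_measure0 _ _ _ supp).
  - by apply: measurableC; exact: real_segment_measurable.
  - exact: measurableC.
  - exact: subsetC.
have mu1 : mu_t setT = 1%E.
  rewrite /mu_t /= /mixture [X in (_ * X + _)%E](probability_setT nu) mule1.
  under eq_bigr => i _ do rewrite [X in (_ * X)%E](probability_setT (omega i)) mule1.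
  by rewrite sumEFin -EFinD -htsum big_ord_recl.
have muK : mu_t (~` real_segment a b) = 0%E.
  rewrite /mu_t /= /mixture [X in (_ * X + _)%E]nuK mule0 add0e big1// => i _.
  by rewrite [X in (_ * X)%E]omK mule0.
have mT k : measurable_fun [set: plane R] (fun z => cheb k (clamped_coord a b z)).
  apply: measurableT_comp (clamped_coord_measurable a b).
  exact: continuous_measurable_fun (@cheb_continuous _ _).
have plus1 (mu : {measure set (plane R) -> \bar R}) k : mu setT = 1%E ->
    (\int[mu]_z (1 + cheb k (clamped_coord a b z))%:E =
     (1 + \int[mu]_z cheb k (clamped_coord a b z))%R%:E)%E.
  move=> m1.
  have ic : mu.-integrable setT (EFin \o (fun z => cheb k (clamped_coord a b z))).
    apply: (bounded_integrable m1 (mT k) (M := 1)) => z.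
    exact: cheb_le1 (clamped_coord_bound a b z).
  rewrite integralD_EFin//=; last exact: (bounded_integrable m1 (f := cst 1) (M := `|1|)).
  rewrite [X in (X + _)%E]integral_cst// m1 mule1 EFinD; congr (_ + _)%E.
  by rewrite /Rintegral fineK//; exact: integrable_fin_num.
have mom k : (\int[mu_t]_x cheb k.+1 (clamped_coord a b x))%R = \sum_j tt j * eta j ^+ k.+1.
  suff : (\int[mu_t]_z (1 + cheb k.+1 (clamped_coord a b z))%:E =
      (1 + \sum_j tt j * eta j ^+ k.+1)%:E)%E.
    by rewrite plus1// => -[/addrI].
  rewrite ge0_integral_mixture.
  - have nu0 : (\int[nu]_z (1 + cheb k.+1 (clamped_coord a b z))%:E = 1)%E.
      rewrite (plus1 nu); last exact: probability_setT.
      rewrite -[RHS]/((1 : R)%:E) -[in RHS](addr0 1).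
      congr ((1 + _)%:E); exact: equilibrium_moments hnu k.
    have om0 i : (\int[omega i]_z (1 + cheb k.+1 (clamped_coord a b z))%:E =
        (1 + e i ^+ k.+1)%:E)%E.
      rewrite (plus1 (omega i)); last exact: probability_setT.
      by congr ((1 + _)%:E); exact: (he i).2.
    rewrite [X in (_ * X + _)%E]nu0 mule1.
    under eq_bigr => i _ do rewrite [X in (_ * X)%E]om0 -EFinM mulrDr mulr1.
    rewrite sumEFin -EFinD; congr (_%:E).
    rewrite big_split/= addrA -[RHS]/(1 + _).
    rewrite -[X in _ = X + _]htsum !big_ord_recl/= /eta unlift_none expr0n.
    rewrite mulr0 add0r; congr (_ + _).
    by apply: eq_bigr => i _; rewrite liftK.
  - by apply/measurable_EFinP; exact: measurable_funD.
  - move=> z; rewrite lee_fin.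
    by have := cheb_le1 k.+1 (clamped_coord_bound a b z); rewrite ler_norml => /andP[]; lra.
have pot := integral_log_abs hab mu1 muK tt0 htsum eta1 mom.
have h0 := halflen_gt0 hab.
have N1 : (-1 : R[i]) != 0 by rewrite oppr_eq0 oner_neq0.
have hA : halflen a b != 0 by rewrite gt_eqF.
(* The endpoints a and b are J(-1) and J(1). *)
have ja : affine_coord a b (real_pt a) = jouk (-1).
  rewrite affine_coord_real jouk_unit ?normcN ?normc1//; congr (_%:C%C).
  by rewrite /= /midpt /halflen; field; rewrite subr_eq0 gt_eqF.
have jb : affine_coord a b (real_pt b) = jouk 1.
  rewrite affine_coord_real jouk_unit ?normc1//; congr (_%:C%C).
  by rewrite /= /midpt /halflen; field; rewrite subr_eq0 gt_eqF.
rewrite (pot _ _ N1 _ ja) ?normcN ?normc1// (pot _ _ (oner_neq0 _) _ jb) ?normc1//.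
rewrite !lee_fin mulr1 ![_ + ln _]addrC => ha hb Q Q0.
have mK := real_segment_measurable a b.
have factor (r : R[i]) : exists g : plane R -> \bar R,
    [/\ mu_t.-integrable setT g,
        forall z, real_segment a b z -> lne (normc (toC z - r))%:E = g z &
        (0 <= \int[mu_t]_z g z)%E].
  pose p : plane R := (complex.Re r, complex.Im r).
  have [w [w0 w1 pw]] := jouk_surj (affine_coord a b p).
  have [ki ke] := integral_lne_kern mu1 (clamped_coord_measurable a b)
    (clamped_coord_bound a b) tt0 htsum eta1 mom w1.
  have rp : r = toC p by rewrite /p /toC; case: (r).
  set c := ln (halflen a b / (2 * normc w)).
  exists (fun z => lne (kern w (clamped_coord a b z))%:E + c%:E)%E; split.
  - apply: integrableD => //.
    exact: (bounded_integrable mu1 (f := cst c) (M := `|c|)).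
  - by move=> z zK; rewrite rp -toCB -(log_abs_kern hab w0 pw zK).
  - rewrite -(eq_integral_supp mK muK (fun z zK => log_abs_kern hab w0 pw zK)).
    rewrite (pot _ _ w0 w1 pw) lee_fin.
    have n0 : 0 < normc w by rewrite normc_gt0.
    have -> : ln (halflen a b / (2 * normc w)) = ln (halflen a b / 2) - ln (normc w).
      have h2 : 0 < halflen a b / 2 by rewrite divr_gt0.
      by rewrite -ln_div ?posrE// -mulrA -invfM.
    have := mixpot_lower tt0 htsum eta1 w0 w1 hb ha.
    by rewrite addrA [mixpot _ _ _ + _]addrC.
pose P : {poly R[i]} := map_poly (fun m : int => m%:~R : R[i]) Q.
have [rs PE] := closed_field_poly_normal P.
have lc : 1 <= normc (lead_coef P).
  rewrite /P lead_coef_map_inj ?mulr0z//; last first.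
    by move=> u v /eqP; rewrite eqr_int => /eqP.
  rewrite normc_int -[1]/(1%:~R) ler_int.
  by rewrite -gtz0_ge1 normr_gt0 lead_coef_eq0.
have [G [Gi GE G0]] : exists G : plane R -> \bar R,
    [/\ mu_t.-integrable setT G,
        forall z, real_segment a b z ->
          lne (normc (lead_coef P * \prod_(r <- rs) (toC z - r)))%:E = G z &
        (0 <= \int[mu_t]_z G z)%E].
  elim: rs {PE} => [|r rs [G [Gi GE G0]]].
    exists (cst (ln (normc (lead_coef P)))%:E); split.
    - exact: (bounded_integrable mu1 (f := cst (ln (normc (lead_coef P))))
        (M := `|ln (normc (lead_coef P))|)).
    - by move=> z _; rewrite big_nil mulr1 lne_EFin// (lt_le_trans _ lc).
    - by rewrite integral_cst// [X in (_ * X)%E]mu1 mule1 lee_fin ln_ge0.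
  have [g [gi gE g0]] := factor r.
  exists (g \+ G)%E; split; first exact: integrableD.
    by move=> z zK; rewrite big_cons mulrCA normcM lne_mul ?normc_ge0// gE// GE.
  by rewrite integralD// adde_ge0.
rewrite (eq_integral_supp mK muK (g := G))// => z zK.
rewrite -GE// /log_abs_poly -/P; congr (lne (normc _)%:E).
rewrite [in LHS]PE hornerZ horner_prod; congr (_ * _).
by apply: eq_bigr => r _; rewrite hornerXsubC.
Qed.
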